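(* Let $f:\mathbb{R}^n_{++}\to\mathbb{R}$ be a symmetric function and let $A\in\mathbb{P}(2n)$ be such that $f$ is locally Lipschitz near $d(A)$. Then the Clarke generalized gradient of $f\circ d$ at $A$ is given by $$\partial(f\circ d)(A)=\left\{\tfrac12\,M D_y M^\top \;:\; y\in\partial f(d(A)),\ M\in\mathrm{SP}^\uparrow(2n,A)\right\}.$$
   Context: $n$ is a positive integer and $\mathbb{R}^n_{++}$ is the set of vectors in $\mathbb{R}^n$ with strictly positive entries. $\mathbb{S}(2n)$ is the space of real symmetric $2n\times 2n$ matrices with inner product $\langle A,B\rangle=\operatorname{Tr}(A^\top B)$ and the induced (Frobenius) norm; $\mathbb{P}(2n)\subset\mathbb{S}(2n)$ is the open subset of positive definite matrices. For $x\in\mathbb{R}^n$, $D_x:=\operatorname{Diag}(x)\oplus\operatorname{Diag}(x)$. A real $2n\times 2n$ matrix $M$ is symplectic if $M^\top JM=J$ with $J=\begin{pmatrix}0&I_n\\-I_n&0\end{pmatrix}$. By Williamson's theorem, for each $A\in\mathbb{P}(2n)$ there is a unique vector $d(A)=(d_1(A),\dots,d_n(A))\in\mathbb{R}^n_{++}$ with $d_1(A)\le\cdots\le d_n(A)$ such that $M^\top AM=D_{d(A)}$ for some symplectic $M$. $\mathrm{SP}^\uparrow(2n,A)$ denotes the set of all symplectic $M$ with $M^\top AM=D_{d(A)}$. A function $f:\mathbb{R}^n_{++}\to\mathbb{R}$ is symmetric if $f(Px)=f(x)$ for all $x\in\mathbb{R}^n_{++}$ and all $n\times n$ permutation matrices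 $P$. For a real function $\phi$ on an open subset of a finite-dimensional Euclidean space $E$ that is locally Lipschitz near $x$, the Clarke generalized directional derivative is $\phi^\circ(x;u)=\limsup_{y\to x,\,t\searrow0}\frac{\phi(y+tu)-\phi(y)}{t}$ for $u\in E$, and the Clarke generalized gradient is $\partial\phi(x)=\{y\in E:\langle y,u\rangle\le\phi^\circ(x;u)\ \forall u\in E\}$. Here $E=\mathbb{R}^n$ for $f$ and $E=\mathbb{S}(2n)$ for $f\circ d$; since $d$ is locally Lipschitz, $f\circ d$ is locally Lipschitz near $A$ when $f$ is locally Lipschitz near $d(A)$. *)

(* Defs.v *)
From HB Require Import structures.
From mathcomp Require Import all_boot all_order all_algebra all_fingroup.
From mathcomp Require Import all_classical all_reals all_analysis.
Set Implicit Arguments.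
Unset Strict Implicit.
Unset Printing Implicit Defensive.
Import Order.TTheory GRing.Theory Num.Theory.
Import numFieldNormedType.Exports.
Local Open Scope classical_set_scope.
Local Open Scope ring_scope.

(* Both Euclidean spaces at hand, 'cV[R]_n and the symmetric matrices of size
   n + n, are spaces of matrices with this inner product. The topology of
   'M[R]_(p, q) in the library is the one of the entrywise max norm, which is
   also the one induced by frobenius_norm. *)
Definition frobenius_dot (R : realType) (p q : nat) (A B : 'M[R]_(p, q)) : R :=
  \tr (A^T *m B).

Definition frobenius_norm (R : realType) (p q : nat) (A : 'M[R]_(p, q)) : R :=
  Num.sqrt (frobenius_dot A A).

(* In the next three definitions a function on an open subset O of a Euclidean
   space is represented by a total function phi; at a point x of O, only the
   values of phi near x matter, hence only values on O. The space itself is a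
   linear subspace E of 'M[R]_(p, q), and neighborhoods are taken relative
   to E. *)
Definition locally_lipschitz_near (R : realType) (p q : nat)
    (E : set 'M[R]_(p, q)) (phi : 'M[R]_(p, q) -> R) (x : 'M[R]_(p, q)) : Prop :=
  exists K : R, exists2 U : set 'M[R]_(p, q), within E (nbhs x) U &
    forall y z, E y -> E z -> U y -> U z ->
      `|phi y - phi z| <= K * frobenius_norm (y - z).

Definition clarke_derivative (R : realType) (p q : nat)
    (E : set 'M[R]_(p, q)) (phi : 'M[R]_(p, q) -> R) (x u : 'M[R]_(p, q)) :
    \bar R :=
  limf_esup
    (fun yt : 'M[R]_(p, q) * R =>
       ((phi (yt.1 + yt.2 *: u) - phi yt.1) / yt.2)%:E)
    (filter_prod (within E (nbhs x)) 0^'+).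

Definition clarke_gradient (R : realType) (p q : nat)
    (E : set 'M[R]_(p, q)) (phi : 'M[R]_(p, q) -> R) (x : 'M[R]_(p, q)) :
    set 'M[R]_(p, q) :=
  [set y | E y /\
    forall u, E u -> ((frobenius_dot y u)%:E <= clarke_derivative E phi x u)%E].

Definition symmetric_matrices (R : realType) (m : nat) : set 'M[R]_m :=
  [set A | A^T = A].
Arguments symmetric_matrices : clear implicits.

Definition positive_definite (R : realType) (m : nat) (A : 'M[R]_m) : Prop :=
  symmetric_matrices R m A /\
  forall v : 'cV[R]_m, v != 0 -> 0 < (v^T *m A *m v) 0 0.

Definition positive_vectors (R : realType) (n : nat) : set 'cV[R]_n :=
  [set x | forall i, 0 < x i 0].
Arguments positive_vectors : clear implicits.

Definition symmetric_function (R : realType) (n : nat) (f : 'cV[R]_n -> R) :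
    Prop :=
  forall (x : 'cV[R]_n) (s : 'S_n), positive_vectors R n x ->
    f (perm_mx s *m x) = f x.

Definition Jmx (R : realType) (n : nat) : 'M[R]_(n + n) :=
  block_mx 0 1%:M (- 1%:M) 0.
Arguments Jmx : clear implicits.

Definition symplectic (R : realType) (n : nat) (M : 'M[R]_(n + n)) : Prop :=
  M^T *m Jmx R n *m M = Jmx R n.

Definition Dmx (R : realType) (n : nat) (x : 'cV[R]_n) : 'M[R]_(n + n) :=
  block_mx (diag_mx x^T) 0 0 (diag_mx x^T).

Definition is_symplectic_spectrum (R : realType) (n : nat)
    (A : 'M[R]_(n + n)) (x : 'cV[R]_n) : Prop :=
  [/\ positive_vectors R n x,
      forall i j : 'I_n, (i <= j)%N -> x i 0 <= x j 0 &
      exists2 M, symplectic M & M^T *m A *m M = Dmx x].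

(* By Williamson's theorem, for A positive definite there is exactly one vector
   as above; the default value 0 is only taken at other matrices. *)
Definition symplectic_spectrum (R : realType) (n : nat) (A : 'M[R]_(n + n)) :
    'cV[R]_n :=
  xget 0 [set x | is_symplectic_spectrum A x].

Definition SPup (R : realType) (n : nat) (A : 'M[R]_(n + n)) :
    set 'M[R]_(n + n) :=
  [set M | symplectic M /\ M^T *m A *m M = Dmx (symplectic_spectrum A)].

(* Main.v *)
(* Write phi = f o d. Since phi is invariant under symplectic congruence, one may
   take A = D_d with d = d(A). Two inequalities between Clarke derivatives are
   needed.

   For f^o(d; g) <= phi^o(D_d; G), where g collects the means of the two diagonal
   entries of G in each mode: D_g is an average of congruences of G by elements of
   the stabilizer of D_d (J and sign changes), phi^o is sublinear and invariant,
   and phi(D_x) = f(x).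

   For phi^o(D_d; D_u) <= f^o(d; u): along the segment from B to B + t D_u, phi has
   at each point the one-sided slope of f in a direction S u, where S is computed
   from a diagonalizing symplectic matrix. Near D_d such matrices are close to the
   stabilizer, for which S is bistochastic on the blocks where d is constant, so
   that S u lies in the convex hull of the permutations of u fixing d. A Dini
   derivative argument integrates the slopes.

   Finally, a Clarke subgradient Y at D_d is orthogonal to the orbit of D_d, i.e.
   to all X^T D_d + D_d X with X infinitesimally symplectic; this makes Y commute
   with J and with D_d, hence be diagonalizable within the stabilizer of D_d. *)

Require Import Defs.
From HB Require Import structures.
From mathcomp Require Import all_boot all_order all_algebra all_fingroup.
From mathcomp Require Import all_classical all_reals all_analysis.
From mathcomp Require Import ring lra.
Set Implicit Arguments.
Unset Strict Implicit.
Unset Printing Implicit Defensive.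
Import Order.TTheory GRing.Theory Num.Theory.
Import numFieldNormedType.Exports.
Local Open Scope classical_set_scope.
Local Open Scope ring_scope.

(** * Matrix norms and topology *)

(** A diagonalizing symplectic matrix is neither unique nor a continuous function of [B], and the
    symplectic group is not compact, so [d] is never differentiated along a choice of eigenbasis.
    Monotonicity of [d] for the order of quadratic forms takes over: it gives uniqueness and local
    Lipschitz continuity of [d], and the latter bounds the diagonalizing matrices near [A]. Orbit
    directions are realized by transvections [1 + t v v^T J]: they are symplectic for every [t], and
    the [v v^T] span the symmetric [W], for which [W J] runs over the infinitesimally symplectic
    matrices. Errors along them are polynomial in [t] and are absorbed by the Lipschitz constant of
    [f o d]. The stabilizer of [D_d] is a compact group of orthogonal matrices commuting with [J];
    inside it, Cayley curves play the role of transvections. The factor 1/2 in the formula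
    compensates [<D_x, D_y> = 2 <x, y>]. *)

Section MatrixNorm.
Context {R : realType}.

Lemma ler_sum_const p (F : 'I_p -> R) c :
  (forall i, F i <= c) -> \sum_i F i <= p%:R * c.
Proof.
move=> Fc; rewrite (le_trans (ler_sum _ (fun i _ => Fc i)))//.
by rewrite sumr_const card_ord mulr_natl.
Qed.

Lemma le_coord_norm p q (A : 'M[R]_(p, q)) i j : `|A i j| <= `|A|.
Proof.
rewrite [leRHS]/Num.norm /= mx_normrE.
exact: (le_bigmax _ (fun ij : 'I_p * 'I_q => `|A ij.1 ij.2|) (i, j)).
Qed.

Lemma norm_mx_le p q (A : 'M[R]_(p, q)) c :
  0 <= c -> (forall i j, `|A i j| <= c) -> `|A| <= c.
Proof.
by move=> c0 Ac; rewrite [leLHS]/Num.norm /= mx_normrE; apply/bigmax_leP.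
Qed.

Lemma norm_mulmx_le p q r (A : 'M[R]_(p, q)) (B : 'M[R]_(q, r)) :
  `|A *m B| <= q%:R * (`|A| * `|B|).
Proof.
apply: norm_mx_le => [|i j]; first by rewrite !mulr_ge0.
rewrite mxE (le_trans (ler_norm_sum _ _ _))//.
by apply: ler_sum_const => k; rewrite normrM ler_pM ?le_coord_norm.
Qed.

Lemma norm_trmx p q (A : 'M[R]_(p, q)) : `|A^T| = `|A|.
Proof.
apply/eqP; rewrite eq_le; apply/andP; split.
  by apply: norm_mx_le => // i j; rewrite mxE le_coord_norm.
by apply: norm_mx_le => // i j; have := le_coord_norm A^T j i; rewrite mxE.
Qed.

Lemma norm_mxtrace_le p (A : 'M[R]_p) : `|\tr A| <= p%:R * `|A|.
Proof.
rewrite (le_trans (ler_norm_sum _ _ _))//.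
by apply: ler_sum_const => k; exact: le_coord_norm.
Qed.

Lemma frobenius_dotE p q (A B : 'M[R]_(p, q)) :
  frobenius_dot A B = \sum_j \sum_i A i j * B i j.
Proof.
apply: eq_bigr => j _; rewrite mxE; apply: eq_bigr => i _.
by rewrite mxE.
Qed.

Lemma frobenius_dot_ge0 p q (A : 'M[R]_(p, q)) : 0 <= frobenius_dot A A.
Proof.
by rewrite frobenius_dotE; do 2!apply: sumr_ge0 => ? _; rewrite -expr2 sqr_ge0.
Qed.

Lemma sqr_coord_le_frobenius p q (A : 'M[R]_(p, q)) i j :
  A i j ^+ 2 <= frobenius_dot A A.
Proof.
rewrite frobenius_dotE (bigD1 j)//= (bigD1 i)//= -expr2 -addrA lerDl.
rewrite addr_ge0//; first by apply: sumr_ge0 => k _; rewrite -expr2 sqr_ge0.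
by do 2!apply: sumr_ge0 => ? _; rewrite -expr2 sqr_ge0.
Qed.

Lemma frobenius_dot_eq0 p q (A : 'M[R]_(p, q)) : frobenius_dot A A <= 0 -> A = 0.
Proof.
move=> A0; apply/matrixP => i j; rewrite mxE; apply/eqP.
rewrite -sqrf_eq0 eq_le sqr_ge0 andbT.
exact: le_trans (sqr_coord_le_frobenius _ _ _) A0.
Qed.

Lemma frobenius_norm_le p q (A : 'M[R]_(p, q)) :
  frobenius_norm A <= (p * q)%:R * `|A|.
Proof.
rewrite -[leRHS]ger0_norm ?mulr_ge0// -sqrtr_sqr ler_wsqrtr//.
rewrite frobenius_dotE.
rewrite (@le_trans _ _ (q%:R * (p%:R * `|A| ^+ 2)))//.
  apply: ler_sum_const => j; apply: ler_sum_const => i.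
  rewrite -expr2 -[leLHS]ger0_norm ?sqr_ge0// normrX.
  by rewrite lerXn2r ?nnegrE// le_coord_norm.
rewrite mulrA exprMn ler_wpM2r ?sqr_ge0//.
rewrite -natrM mulnC -natrX ler_nat -mulnn.
by case: (p * q)%N => // k; exact: leq_pmulr.
Qed.
End MatrixNorm.

(** * Convergence, compactness and minimizers in matrix spaces *)

Section MatrixTopology.
Context {R : realType}.

Lemma cvg_mx (T : Type) (F : set_system T) {FF : Filter F} p q
    (f : T -> 'M[R]_(p, q)) (A : 'M[R]_(p, q)) :
  (forall i j, f x i j @[x --> F] --> A i j) -> f @ F --> A.
Proof.
move=> fA; apply/cvgrPdist_le => e e0.
have : \forall x \near F, forall i j, `|A i j - f x i j| <= e.
  apply: filter_forall => i; apply: filter_forall => j.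
  by have /cvgrPdist_le/(_ _ e0) := fA i j.
apply: filterS => x fAe; apply: norm_mx_le => [|i j]; first exact: ltW.
by rewrite !mxE.
Qed.

Lemma cvg_coord (T : Type) (F : set_system T) {FF : Filter F} p q
    (f : T -> 'M[R]_(p, q)) (A : 'M[R]_(p, q)) i j :
  f @ F --> A -> f x i j @[x --> F] --> A i j.
Proof.
move=> fA.
exact: (cvg_comp _ _ fA (@coord_continuous _ _ _ i j A)).
Qed.

Lemma cvg_bigsum (T : Type) (F : set_system T) {FF : Filter F} (I : Type)
    (r : seq I) (P : pred I) (f : I -> T -> R) (a : I -> R) :
  (forall i, f i @ F --> a i) ->
  \sum_(i <- r | P i) f i x @[x --> F] --> \sum_(i <- r | P i) a i.
Proof.
move=> fa; elim: r => [|i r IH].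
  by under eq_fun do rewrite big_nil; rewrite big_nil; exact: cvg_cst.
under eq_fun do rewrite big_cons; rewrite big_cons; case: (P i) => //.
exact: cvgD.
Qed.

Lemma cvg_mulmx (T : Type) (F : set_system T) {FF : Filter F} p q r
    (f : T -> 'M[R]_(p, q)) (g : T -> 'M[R]_(q, r))
    (A : 'M[R]_(p, q)) (B : 'M[R]_(q, r)) :
  f @ F --> A -> g @ F --> B -> f x *m g x @[x --> F] --> A *m B.
Proof.
move=> fA gB; apply: cvg_mx => i j; under eq_fun do rewrite mxE.
by rewrite mxE; apply: cvg_bigsum => k; apply: cvgM; exact: cvg_coord.
Qed.

Lemma cvg_trmx (T : Type) (F : set_system T) {FF : Filter F} p q
    (f : T -> 'M[R]_(p, q)) (A : 'M[R]_(p, q)) :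
  f @ F --> A -> (f x)^T @[x --> F] --> A^T.
Proof.
move=> fA; apply: cvg_mx => i j; under eq_fun do rewrite mxE.
by rewrite mxE; exact: cvg_coord.
Qed.

Lemma cvg_mxtrace (T : Type) (F : set_system T) {FF : Filter F} p
    (f : T -> 'M[R]_p) (A : 'M[R]_p) :
  f @ F --> A -> \tr (f x) @[x --> F] --> \tr A.
Proof. by move=> fA; apply: cvg_bigsum => k; exact: cvg_coord. Qed.

Lemma compact_mx_bounded p q (A : set 'M[R]_(p, q)) c :
  closed A -> (forall M, A M -> `|M| <= c) -> compact A.
Proof.
move=> Acl Ac.
pose box := [set v : 'rV[R]_(p * q) | forall i, `[- c, c]%classic (v ord0 i)].
have cbox : compact box.
  apply: (@rV_compact _ _ (fun=> `[- c, c]%classic)) => _.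
  exact: segment_compact.
have cvec : continuous (fun v : 'rV[R]_(p * q) => vec_mx v).
  move=> v; apply: (@cvg_mx _ (nbhs v)) => i j; under eq_fun do rewrite mxE.
  by rewrite mxE; exact: coord_continuous.
have /subclosed_compact : compact [set vec_mx v | v in box].
  by apply: continuous_compact cbox; exact: continuous_subspaceT.
apply=> // M /Ac Mc; exists (mxvec M); last exact: mxvecK.
move=> k; case/mxvec_indexP: k => i j.
by rewrite mxvecE /= in_itv /= -ler_norml (le_trans (le_coord_norm _ _ _)).
Qed.

(** Only the sublevel set of [M0] has to be bounded, hence compact; this gives minimizers on
    noncompact constraint sets such as the symplectic group. *)
Lemma closed_min_mx p q (A : set 'M[R]_(p, q)) (f : 'M[R]_(p, q) -> R) c M0 :
  closed A -> continuous f -> A M0 ->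
  (forall M, A M -> f M <= f M0 -> `|M| <= c) ->
  exists2 M, A M & forall M', A M' -> f M <= f M'.
Proof.
move=> Acl cf AM0 Ac; pose K := A `&` [set M | f M <= f M0].
have [||M /set_mem[AM fM] Mmin] :=
  @compact_EVT_min _ _ f K _ _ (continuous_subspaceT cf).
- by exists M0; split=> //=.
- apply: (@compact_mx_bounded _ _ _ c) => [|M []]; last exact: Ac.
  apply: closedI => //; apply: closed_comp (@closed_le R _) => x _; exact: cf.
exists M => // M' AM'; have [fM'|/ltW fM'] := leP (f M') (f M0).
  by apply: Mmin; rewrite inE.
exact: le_trans fM fM'.
Qed.

Lemma closed_eq_continuous (T : topologicalType) (V : normedModType R)
    (f g : T -> V) :
  continuous f -> continuous g -> closed [set M | f M = g M].
Proof.
move=> cf cg.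
have -> : [set M | f M = g M] = (fun M => f M - g M) @^-1` [set 0].
  apply/seteqP; split=> M /=; first by move->; rewrite subrr.
  by move/subr0_eq.
apply: closed_comp => [M _|].
  by apply: cvgB; [exact: cf|exact: cg].
apply: accessible_closed_set1; apply: hausdorff_accessible.
exact: norm_hausdorff.
Qed.

Lemma trmx_continuous p q : continuous (fun A : 'M[R]_(p, q) => A^T).
Proof. by move=> A; apply: (@cvg_trmx _ (nbhs A)); exact: cvg_id. Qed.

End MatrixTopology.

(** * Algebra of the symplectic form *)

Section SymplecticAlgebra.
Context {R : realType} {n : nat}.
Implicit Types (M B X Z W : 'M[R]_(n + n)) (x y w : 'cV[R]_n).
Local Notation J := (Jmx R n).

Definition dbl x : 'rV[R]_(n + n) := row_mx x^T x^T.

Lemma dbl_lshift x i : dbl x 0 (lshift n i) = x i 0.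
Proof. by rewrite row_mxEl mxE. Qed.

Lemma dbl_rshift x i : dbl x 0 (rshift n i) = x i 0.
Proof. by rewrite row_mxEr mxE. Qed.

Lemma Dmx_diag x : Dmx x = diag_mx (dbl x).
Proof. by rewrite /Dmx /dbl diag_mx_row. Qed.

Lemma mul_Dmx x (p : nat) (X : 'M[R]_(n + n, p)) i j :
  (Dmx x *m X) i j = dbl x 0 i * X i j.
Proof. by rewrite Dmx_diag mul_diag_mx mxE. Qed.

Lemma mulmx_Dmx x (p : nat) (X : 'M[R]_(p, n + n)) i j :
  (X *m Dmx x) i j = X i j * dbl x 0 j.
Proof. by rewrite Dmx_diag mul_mx_diag mxE. Qed.

Lemma DmxE x i j : Dmx x i j = dbl x 0 i *+ (i == j).
Proof. by rewrite Dmx_diag mxE. Qed.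

Lemma dbl_gt0 x : positive_vectors R n x -> forall i, 0 < dbl x 0 i.
Proof.
move=> x0 i; case: (split_ordP i) => k ->.
- by rewrite dbl_lshift.
- by rewrite dbl_rshift.
Qed.

Lemma tr_Dmx x : (Dmx x)^T = Dmx x.
Proof. by rewrite Dmx_diag tr_diag_mx. Qed.

Lemma tr_Jmx : J^T = - J.
Proof.
by rewrite /Jmx tr_block_mx opp_block_mx !linear0 linearN /= trmx1 opprK.
Qed.

Lemma mul_Jmx_Jmx : J *m J = - 1%:M.
Proof.
rewrite /Jmx mulmx_block !mul0mx !mulmx0 !mul1mx !mulmx1 !add0r !addr0.
by rewrite (scalar_mx_block n n (1 : R)) opp_block_mx !oppr0.
Qed.

Lemma Jmx_Dmx x : J *m Dmx x = Dmx x *m J.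
Proof.
rewrite /Jmx /Dmx !mulmx_block !mul0mx !mulmx0 !mul1mx !mulmx1 !add0r !addr0.
by rewrite mulNmx mulmxN mul1mx mulmx1.
Qed.

Lemma mulmxJJ (p : nat) (X : 'M[R]_(p, n + n)) : X *m J *m J = - X.
Proof. by rewrite -mulmxA mul_Jmx_Jmx mulmxN mulmx1. Qed.

Lemma mulJJmx (p : nat) (X : 'M[R]_(n + n, p)) : J *m (J *m X) = - X.
Proof. by rewrite mulmxA mul_Jmx_Jmx mulNmx mul1mx. Qed.

(** Entrywise the equation reads [(x_i + x_j) X_ij = 0]. *)
Lemma Dmx_anticommute x X : positive_vectors R n x ->
  Dmx x *m X + X *m Dmx x = 0 -> X = 0.
Proof.
move=> x0 /matrixP XD; apply/matrixP => i j.
have := XD i j.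
rewrite mxE mul_Dmx mulmx_Dmx !(mxE const_mx_key) => /eqP.
rewrite [in X in X -> _]mulrC -mulrDr.
by rewrite mulf_eq0 => /orP[/eqP//|]; rewrite gt_eqF// addr_gt0// dbl_gt0.
Qed.

Lemma Dmx_commute x X i j : X *m Dmx x = Dmx x *m X ->
  dbl x 0 i != dbl x 0 j -> X i j = 0.
Proof.
move=> /matrixP/(_ i j)/eqP; rewrite mul_Dmx mulmx_Dmx mulrC -subr_eq0 -mulrBl.
by rewrite mulf_eq0 subr_eq0 eq_sym => /orP[->|/eqP].
Qed.

Lemma Jmx_commuteP X : X *m J = J *m X ->
  X = block_mx (ulsubmx X) (ursubmx X) (- ursubmx X) (ulsubmx X).
Proof.
rewrite -{1 2}[X]submxK /Jmx !mulmx_block !mul0mx !mulmx0 !mul1mx !mulmx1.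
rewrite !add0r !addr0 !mulNmx !mulmxN !mulmx1 !mul1mx => /eq_block_mx[XJ1 XJ2 _ _].
by rewrite -{1}[X]submxK -XJ1 -XJ2.
Qed.

(** Distinct weights kill the entries between different modes. Within a mode, [J] makes the diagonal
    entries equal and the off-diagonal ones opposite, while symmetry makes the latter equal, hence
    zero. *)
Lemma eq_Dmx_of_commute w Z : (forall i j, w i 0 = w j 0 -> i = j) ->
  Z^T = Z -> Z *m J = J *m Z -> Z *m Dmx w = Dmx w *m Z ->
  exists y, Z = Dmx y.
Proof.
move=> w_inj Zsym ZJ ZD.
exists (\col_i Z (lshift n i) (lshift n i)).
have /matrixP ZE := Jmx_commuteP ZJ.
apply/matrixP => i j; rewrite DmxE.
case: (split_ordP i) => k ->; case: (split_ordP j) => l ->.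
- rewrite eq_lshift dbl_lshift mxE; have [->//|kl] := eqVneq k l.
  apply: (Dmx_commute ZD); rewrite !dbl_lshift.
  by apply: contra_neq kl; exact: w_inj.
- rewrite eq_lrshift; have [->|kl] := eqVneq k l; last first.
    apply: (Dmx_commute ZD); rewrite dbl_lshift dbl_rshift.
    by apply: contra_neq kl; exact: w_inj.
  have := ZE (rshift n l) (lshift n l); rewrite block_mxEdl !mxE -{1}Zsym mxE.
  by move=> /eqP; rewrite -addr_eq0 -mulr2n mulrn_eq0 /= => /eqP.
- rewrite eq_rlshift; have [->|kl] := eqVneq k l; last first.
    apply: (Dmx_commute ZD); rewrite dbl_lshift dbl_rshift.
    by apply: contra_neq kl; exact: w_inj.
  have := ZE (rshift n l) (lshift n l); rewrite block_mxEdl !mxE -{2}Zsym mxE.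
  by move=> /eqP; rewrite -addr_eq0 -mulr2n mulrn_eq0 /= => /eqP.
- rewrite eq_rshift dbl_rshift mxE ZE block_mxEdr !mxE; have [->//|kl] := eqVneq k l.
  apply: (Dmx_commute ZD); rewrite !dbl_lshift.
  by apply: contra_neq kl; exact: w_inj.
Qed.

(** Multiplying by [J] on both sides gives the companion identity [Z J D = D J Z]. Together the two
    say that [Z J - J Z] anticommutes with [D], so it vanishes; cancelling [J] gives the other
    commutation. *)
Lemma commute_of_twisted x Z : positive_vectors R n x ->
  J *m Z *m Dmx x = Dmx x *m Z *m J ->
  Z *m J = J *m Z /\ Z *m Dmx x = Dmx x *m Z.
Proof.
move=> x0 JZD.
have JZD' : Z *m J *m Dmx x = Dmx x *m J *m Z.
  apply: oppr_inj.
  transitivity (J *m (J *m Z *m Dmx x) *m J).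
    by rewrite !mulmxA mul_Jmx_Jmx mulNmx mul1mx !mulNmx -!mulmxA -Jmx_Dmx.
  by rewrite JZD !mulmxA mulmxJJ Jmx_Dmx.
have ZJ : Z *m J = J *m Z.
  apply/eqP; rewrite -subr_eq0; apply/eqP; apply: (Dmx_anticommute x0).
  rewrite mulmxBr mulmxBl JZD' JZD !mulmxA.
  by rewrite addrA subrK subrr.
split=> //.
have := congr1 (mulmx J) JZD; rewrite -[Dmx x *m Z *m J]mulmxA ZJ.
rewrite -[J *m Z *m _]mulmxA mulJJmx [Dmx x *m _]mulmxA -Jmx_Dmx.
by rewrite -mulmxA mulJJmx => /oppr_inj.
Qed.

(** With [X = W J] this is [D X + X^T D] for [D = Dmx x]; when [W] is symmetric, [X] is
    infinitesimally symplectic and this is a velocity of the congruence orbit of [D]. *)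
Definition tangent x W := Dmx x *m W *m J + (Dmx x *m W *m J)^T.

Lemma tr_tangent x W : (tangent x W)^T = tangent x W.
Proof. by rewrite /tangent linearD /= trmxK addrC. Qed.

Lemma frobenius_dot_tangent x W Z : Z^T = Z ->
  frobenius_dot Z (tangent x W) = 2 * \tr (J *m Z *m Dmx x *m W).
Proof.
move=> Zsym; rewrite /frobenius_dot Zsym /tangent mulmxDr linearD /=.
rewrite -[X in _ + X]mxtrace_tr trmx_mul trmxK Zsym [X in _ + X]mxtrace_mulC.
have -> : \tr (J *m Z *m Dmx x *m W) = \tr (Z *m (Dmx x *m W *m J)).
  by rewrite -!mulmxA mxtrace_mulC !mulmxA.
by rewrite mulr_natl mulr2n.
Qed.

Lemma twisted_skew x Z : Z^T = Z ->
  (J *m Z *m Dmx x)^T = - (Dmx x *m Z *m J).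
Proof. by move=> Zsym; rewrite !trmx_mul tr_Dmx Zsym tr_Jmx !mulmxN mulmxA. Qed.

Lemma tr_skew_sym K W : K^T = - K -> W^T = W -> \tr (K *m W) = 0.
Proof.
move=> Kskew Wsym; suff : \tr (K *m W) = - \tr (K *m W) by lra.
rewrite -{1}[K *m W]trmxK mxtrace_tr trmx_mul Kskew Wsym mulmxN linearN /=.
by rewrite mxtrace_mulC.
Qed.

Lemma commute_tangent_orth x W Z : Z^T = Z -> W^T = W ->
  Z *m J = J *m Z -> Z *m Dmx x = Dmx x *m Z ->
  frobenius_dot Z (tangent x W) = 0.
Proof.
move=> Zsym Wsym ZJ ZD; rewrite frobenius_dot_tangent// tr_skew_sym ?mulr0//.
by rewrite twisted_skew// -ZD -ZJ -!mulmxA Jmx_Dmx.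
Qed.

(** By polarization the matrices [v v^T] of these vectors span the symmetric matrices; rank one is
    what makes [1 + t v v^T J] a transvection. *)
Definition polar_vector (ij : 'I_(n + n) * 'I_(n + n)) : 'cV[R]_(n + n) :=
  delta_mx ij.1 0 + delta_mx ij.2 0.

Lemma mxtrace_mul_delta p (K : 'M[R]_p) k l :
  \tr (K *m (delta_mx k (0 : 'I_1) *m (delta_mx l 0)^T)) = K l k.
Proof.
rewrite trmx_delta mul_delta_mx /mxtrace (bigD1 l)//= big1 => [|i il].
  rewrite mxE (bigD1 k)//= big1 ?addr0 => [|j jk]; last first.
    by rewrite mxE (negPf jk) mulr0.
  by rewrite mxE !eqxx mulr1.
by rewrite mxE big1// => j _; rewrite mxE (negPf il) andbF mulr0.
Qed.

Lemma skew_of_polar K :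
  (forall ij, \tr (K *m (polar_vector ij *m (polar_vector ij)^T)) = 0) ->
  K^T = - K.
Proof.
move=> K0; have KE i j : K i i + K j j + K i j + K j i = 0.
  rewrite -(K0 (i, j)) /polar_vector /= linearD /= !(mulmxDr, mulmxDl).
  rewrite !linearD /= !mxtrace_mul_delta; ring.
apply/matrixP => i j; rewrite !mxE.
by have := (KE i i, KE j j, KE i j) => -[[]]; lra.
Qed.

(** Orthogonality to these directions makes [J Z D] skew, which is the twisted commutation
    identity. *)
Lemma tangent_orth_commute x Z : positive_vectors R n x -> Z^T = Z ->
  (forall ij, frobenius_dot Z
    (tangent x (polar_vector ij *m (polar_vector ij)^T)) = 0) ->
  Z *m J = J *m Z /\ Z *m Dmx x = Dmx x *m Z.
Proof.
move=> x0 Zsym Zorth; apply: (commute_of_twisted x0).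
apply: oppr_inj; rewrite -twisted_skew// -skew_of_polar ?trmxK// => ij.
have := Zorth ij; rewrite frobenius_dot_tangent// => /eqP.
by rewrite mulf_eq0 pnatr_eq0 /= => /eqP.
Qed.

End SymplecticAlgebra.

(** * The symplectic group *)

Section SymplecticGroup.
Context {R : realType} {n : nat}.
Implicit Types (M B X Z W : 'M[R]_(n + n)) (x y w : 'cV[R]_n).
Local Notation J := (Jmx R n).

Lemma symplectic1 : symplectic (1%:M : 'M[R]_(n + n)).
Proof. by rewrite /symplectic trmx1 mul1mx mulmx1. Qed.

Lemma symplectic_mul M B : symplectic M -> symplectic B -> symplectic (M *m B).
Proof.
rewrite /symplectic => MJ BJ; rewrite trmx_mul !mulmxA.
by rewrite -(mulmxA _ M^T) -(mulmxA _ _ M) MJ.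
Qed.

Lemma symplectic_Jmx : symplectic J.
Proof. by rewrite /symplectic tr_Jmx mulNmx mul_Jmx_Jmx opprK mul1mx. Qed.

Lemma symplectic_left_inverse M : symplectic M -> (- (J *m M^T *m J)) *m M = 1%:M.
Proof.
by move=> MJ; rewrite mulNmx -!mulmxA (mulmxA M^T) MJ mul_Jmx_Jmx opprK.
Qed.

Lemma symplectic_unitmx M : symplectic M -> M \in unitmx.
Proof. by move=> /symplectic_left_inverse/mulmx1_unit[]. Qed.

Lemma symplectic_tr M : symplectic M -> M *m J *m M^T = J.
Proof.
move=> /symplectic_left_inverse/mulmx1C; rewrite mulmxN => /(congr1 (mulmxr J)) /=.
by rewrite mulNmx !mulmxA mulmxJJ opprK mul1mx.
Qed.

Lemma symplectic_invmx M : symplectic M -> symplectic (invmx M).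
Proof.
move=> MJ; have Mu := symplectic_unitmx MJ.
rewrite /symplectic -{1}MJ trmx_inv !mulmxA mulVmx ?unitmx_tr// mul1mx.
by rewrite -mulmxA mulmxV// mulmx1.
Qed.

Lemma mulmx_form_skew (v : 'cV[R]_(n + n)) : v^T *m J *m v = 0.
Proof.
apply/matrixP => i j; rewrite !ord1 [RHS]mxE.
have : (v^T *m J *m v)^T 0 0 = (v^T *m J *m v) 0 0 by rewrite mxE.
by rewrite !trmx_mul trmxK tr_Jmx mulNmx mulmxN mulmxA mxE; lra.
Qed.

(** The first-order terms cancel since [v v^T] is symmetric, and the second-order one contains the
    scalar [v^T J v = 0]. *)
Lemma symplectic_transvection t (v : 'cV[R]_(n + n)) :
  symplectic (1%:M + t *: (v *m v^T *m J)).
Proof.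
rewrite /symplectic [(_ + _)^T]linearD /= trmx1 [(_ *: _)^T]linearZ /=.
rewrite !trmx_mul trmxK tr_Jmx mulNmx.
rewrite scalerN !mulmxBl mul1mx !mulmxDr !mulmx1 -!scalemxAl -!scalemxAr !mulmxA.
rewrite -(mulmxA _ v^T J) -(mulmxA _ (v^T *m J) v) mulmx_form_skew mulmx0.
by rewrite !mul0mx !scaler0 addr0 addrK.
Qed.

(** Writing [J] as [M J M^T] gives [J D M = M J D], which is the twisted commutation after
    multiplying by [J] on both sides. A symplectic matrix commuting with [J] is orthogonal. *)
Lemma symplectic_stabilizer x M : positive_vectors R n x -> symplectic M ->
  M^T *m Dmx x *m M = Dmx x ->
  [/\ M^T *m M = 1%:M, M *m J = J *m M & M *m Dmx x = Dmx x *m M].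
Proof.
move=> x0 MJ MD.
have JDM : J *m Dmx x *m M = M *m J *m Dmx x.
  by rewrite -{1}(symplectic_tr MJ) -{2}MD !mulmxA.
have [ZJ ZD] : M *m J = J *m M /\ M *m Dmx x = Dmx x *m M.
  apply: (commute_of_twisted x0); apply: oppr_inj.
  rewrite -!mulmxA.
  have := congr1 (fun X => J *m X *m J) JDM; rewrite /= -!mulmxA mulJJmx.
  by rewrite -Jmx_Dmx mulJJmx !mulmxN => ->.
split=> //; move: MJ; rewrite /symplectic -mulmxA -ZJ mulmxA => /(congr1 (mulmxr J)).
by rewrite /= mulmxJJ mul_Jmx_Jmx => /oppr_inj.
Qed.

End SymplecticGroup.

(** * Williamson's theorem *)

Section Williamson.
Context {R : realType}.

(** First-order condition at a minimum: [t = - a / (1 + |b|)] would make the expression a negative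
    multiple of [a^2]. *)
Lemma quadratic_ge0_linear0 (a b : R) : (forall t, 0 <= t * a + t ^+ 2 * b) -> a = 0.
Proof.
move=> ab; apply/eqP; rewrite -sqrf_eq0 eq_le sqr_ge0 andbT.
have b1 : 0 < 1 + `|b| by rewrite ltr_pwDl.
have := ab (- a / (1 + `|b|)).
have -> : - a / (1 + `|b|) * a + (- a / (1 + `|b|)) ^+ 2 * b =
  a ^+ 2 * ((b - 1 - `|b|) / (1 + `|b|) ^+ 2) by field; rewrite gt_eqF.
apply: contraTle => a2; rewrite -ltNge pmulr_rlt0// pmulr_llt0 ?invr_gt0 ?exprn_gt0//.
by have := ler_norm b; lra.
Qed.

(** [m] is the minimum of the form on the unit sphere of the max norm; if that sphere is empty, the
    only vector is 0. *)
Lemma definite_coercive p (A : 'M[R]_p) :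
  (forall v : 'cV[R]_p, v != 0 -> 0 < (v^T *m A *m v) 0 0) ->
  exists2 m, 0 < m & forall v : 'cV[R]_p, m * `|v| ^+ 2 <= (v^T *m A *m v) 0 0.
Proof.
move=> A0; pose S := [set v : 'cV[R]_p | `|v| = 1].
have [[u Su]|S0] := pselect (S !=set0); last first.
  exists 1 => // v; have [->|v0] := eqVneq v 0.
    by rewrite normr0 expr0n mulr0 mulmx0 mxE.
  case: S0; exists (`|v|^-1 *: v).
  by rewrite /S /= normrZ normfV normr_id mulVf// normr_eq0.
have cq : continuous (fun v : 'cV[R]_p => (v^T *m A *m v) 0 0).
  move=> v; apply: (@cvg_coord _ _ (nbhs v)).
  apply: (@cvg_mulmx _ _ (nbhs v)); last exact: cvg_id.
  apply: (@cvg_mulmx _ _ (nbhs v)); last exact: cvg_cst.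
  by apply: (@cvg_trmx _ _ (nbhs v)); exact: cvg_id.
have [||v Sv vmin] := @closed_min_mx _ _ _ S _ 1 u _ cq Su.
- apply: (@closed_eq_continuous _ _ R^o) => w; last exact: cst_continuous.
  exact: norm_continuous.
- by move=> w ->.
have v0 : v != 0 by rewrite -normr_eq0 Sv oner_eq0.
exists ((v^T *m A *m v) 0 0); first exact: A0.
move=> w; have [->|w0] := eqVneq w 0.
  by rewrite normr0 expr0n mulr0 mulmx0 mxE.
have nw : 0 < `|w| by rewrite normr_gt0.
have : S (`|w|^-1 *: w) by rewrite /S /= normrZ normfV normr_id mulVf ?gt_eqF.
move=> /vmin; rewrite [(_ *: _)^T]linearZ /= -!scalemxAl -scalemxAr scalerA.
set q := (v^T *m A *m v) 0 0; rewrite mxE.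
by rewrite -expr2 exprVn ler_pdivlMl ?exprn_gt0// mulrC.
Qed.

Lemma congr_diag p q (M : 'M[R]_(p, q)) (A : 'M[R]_p) j :
  (M^T *m A *m M) j j = ((col j M)^T *m A *m col j M) 0 0.
Proof.
rewrite -!mulmxA [LHS]mxE [RHS]mxE; apply: eq_bigr => k _; rewrite !mxE.
by congr (_ * _); apply: eq_bigr => l _; rewrite !mxE.
Qed.

Lemma mxtrace_sym_swap p (D B X : 'M[R]_p) : D^T = D -> B^T = B ->
  \tr (D *m (X^T *m B)) = \tr (D *m (B *m X)).
Proof.
by move=> DD BB; rewrite -[LHS]mxtrace_tr !trmx_mul trmxK DD BB mxtrace_mulC.
Qed.

Context {n : nat}.
Implicit Types (M A B X Z W : 'M[R]_(n + n)) (x y w : 'cV[R]_n).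
Local Notation J := (Jmx R n).

Lemma Dmx_gt0_congr A M x : positive_definite A -> symplectic M ->
  M^T *m A *m M = Dmx x -> positive_vectors R n x.
Proof.
move=> [_ A0] MJ MA i.
have -> : x i 0 = (M^T *m A *m M) (lshift n i) (lshift n i).
  by rewrite MA DmxE eqxx dbl_lshift.
rewrite congr_diag A0// colE; apply/eqP => /(congr1 (mulmx (invmx M))).
rewrite mulKmx ?symplectic_unitmx// mulmx0 => /matrixP/(_ (lshift n i) 0)/eqP.
by rewrite !mxE !eqxx oner_eq0.
Qed.

Lemma closed_symplectic : closed [set M : 'M[R]_(n + n) | symplectic M].
Proof.
apply: closed_eq_continuous => M; last exact: cst_continuous.
apply: (@cvg_mulmx _ _ (nbhs M)); last exact: cvg_id.
apply: (@cvg_mulmx _ _ (nbhs M)); last exact: cvg_cst.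
exact: trmx_continuous.
Qed.

(* At a minimizer [M] of [tr (D_w M^T A M)] over the symplectic group, the
   derivatives along all transvections vanish; for distinct weights [w] this
   forces [M^T A M] to be of the form [Dmx x]. *)
Lemma williamson_unsorted A : positive_definite A ->
  exists M x, symplectic M /\ M^T *m A *m M = Dmx x.
Proof.
move=> [Asym A0]; have [m m0 Am] := definite_coercive A0.
(* The weights are distinct, which separates the modes at the end, and at least 1, so that [F]
   dominates each diagonal entry of [M^T A M]. *)
pose w : 'cV[R]_n := \col_i i.+1%:R.
have w1 i : 1 <= dbl w 0 i.
  case: (split_ordP i) => k ->.
  - by rewrite dbl_lshift mxE ler1n.
  - by rewrite dbl_rshift mxE ler1n.
have w0 : positive_vectors R n w by move=> i; rewrite mxE ltr0n.
pose F M := \tr (Dmx w *m (M^T *m A *m M)).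
have FE M : F M = \sum_j dbl w 0 j * (M^T *m A *m M) j j.
  by apply: eq_bigr => j _; rewrite mul_Dmx.
have MAM0 M j : 0 <= (M^T *m A *m M) j j.
  by rewrite congr_diag (le_trans _ (Am _))// mulr_ge0 ?sqr_ge0// ltW.
have FM M i j : m * M i j ^+ 2 <= F M.
  rewrite FE (bigD1 j)//= ler_wpDr//.
    by apply: sumr_ge0 => k _; rewrite mulr_ge0// (le_trans _ (w1 _)).
  apply: le_trans (ler_peMl (MAM0 _ _) (w1 _)).
  rewrite congr_diag (le_trans _ (Am _))// ler_pM2l//.
  rewrite -[leLHS]ger0_norm ?sqr_ge0// normrX lerXn2r ?nnegrE//.
  by have := le_coord_norm (col j M) i 0; rewrite mxE.
have cF : continuous F.
  move=> M; apply: (@cvg_mxtrace _ _ (nbhs M)).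
  apply: (@cvg_mulmx _ _ (nbhs M)); first exact: cvg_cst.
  apply: (@cvg_mulmx _ _ (nbhs M)); last exact: cvg_id.
  apply: (@cvg_mulmx _ _ (nbhs M)); last exact: cvg_cst.
  exact: trmx_continuous.
(* The bound on the sublevel set uses that [a^2 <= q] implies [|a| <= 1 + q]. *)
have [|M MJ Mmin] := @closed_min_mx _ _ _ _ _ (1 + F 1%:M / m) _
  closed_symplectic cF symplectic1.
  move=> M _ M1.
  have F1 : 0 <= F 1%:M.
    by rewrite FE; apply: sumr_ge0 => k _; rewrite mulr_ge0// (le_trans _ (w1 _)).
  have q0 : 0 <= F 1%:M / m by rewrite divr_ge0// ltW.
  apply: norm_mx_le => [|i j]; first by rewrite addr_ge0.
  have : `|M i j| ^+ 2 <= F 1%:M / m.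
    rewrite -normrX ger0_norm ?sqr_ge0// ler_pdivlMr// mulrC.
    exact: le_trans (FM _ _ _) M1.
  by have := normr_ge0 (M i j); nra.
pose B := M^T *m A *m M; have BE : M^T *m A *m M = B by [].
have Bsym : B^T = B by rewrite /B !trmx_mul trmxK Asym mulmxA.
(* Passing from [M] to [M (1 + t X)] changes [F] by [2 t tr (D_w B X) + t^2 tr (D_w X^T B X)]; at a
   minimum the linear coefficient vanishes. *)
have JwB : (J *m Dmx w *m B)^T = - (J *m Dmx w *m B).
  apply: skew_of_polar => ij; set v := polar_vector ij.
  pose X := v *m v^T *m J.
  suff E : \tr (Dmx w *m (B *m X)) = 0.
    by move: E; rewrite /X !mulmxA mxtrace_mulC !mulmxA.
  suff : 2 * \tr (Dmx w *m (B *m X)) = 0 by lra.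
  apply: (@quadratic_ge0_linear0 _ (\tr (Dmx w *m (X^T *m B *m X)))) => t.
  have := Mmin _ (symplectic_mul MJ (symplectic_transvection t v)).
  rewrite -/X -subr_ge0 /F; congr (_ <= _).
  have -> : (M *m (1%:M + t *: X))^T *m A *m (M *m (1%:M + t *: X)) =
      (1%:M + t *: X)^T *m B *m (1%:M + t *: X).
    by rewrite trmx_mul /B !mulmxA.
  rewrite [(1%:M + _)^T]linearD /= [(t *: X)^T]linearZ /= trmx1.
  rewrite -/B mulmxDl mul1mx !mulmxDr !mulmx1 -!scalemxAr -!scalemxAl !mulmxDr.
  rewrite -!scalemxAr !linearD /= !linearZ /=.
  have -> : \tr (Dmx w *m (X^T *m B)) = \tr (Dmx w *m (B *m X)).
    by rewrite mxtrace_sym_swap ?tr_Dmx.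
  rewrite (mulmxDl B) -scalemxAl mulmxDr -scalemxAr linearD linearZ /=; ring.
clearbody B.
have [BJ Bw] : B *m J = J *m B /\ B *m Dmx w = Dmx w *m B.
  apply: (commute_of_twisted w0).
  have E : J *m Dmx w *m B = B *m Dmx w *m J.
    by apply: oppr_inj; rewrite -JwB !trmx_mul Bsym tr_Jmx tr_Dmx !mulmxN mulmxA.
  have := congr1 (fun X => J *m X *m J) E; rewrite /= !mulmxA mul_Jmx_Jmx.
  by rewrite !mulNmx mul1mx !mulmxJJ => /oppr_inj ->.
have [//|x Bx] := eq_Dmx_of_commute _ Bsym BJ Bw.
  by move=> i j; rewrite !mxE => /eqP; rewrite eqr_nat eqSS => /eqP/val_inj.
by exists M, x; rewrite BE.
Qed.

End Williamson.

(** * Monotonicity of the symplectic spectrum *)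

Section Spectrum.
Context {R : realType} {n : nat}.
Implicit Types (M A B C X Z W : 'M[R]_(n + n)) (x y w : 'cV[R]_n).
Local Notation J := (Jmx R n).

Definition mode (i : 'I_(n + n)) : 'I_n :=
  match fintype.split i with inl k => k | inr k => k end.

Lemma dblE x i : dbl x 0 i = x (mode i) 0.
Proof.
rewrite /mode; case: split_ordP => k ->.
- by rewrite dbl_lshift.
- by rewrite dbl_rshift.
Qed.

Lemma mode_lshift k : mode (lshift n k) = k.
Proof. by rewrite /mode (unsplitK (inl k : 'I_n + 'I_n)). Qed.

Lemma mode_rshift k : mode (rshift n k) = k.
Proof. by rewrite /mode (unsplitK (inr k : 'I_n + 'I_n)). Qed.

Lemma mul_perm_cV (s : 'S_n) x i : (perm_mx s *m x) i 0 = x (s i) 0.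
Proof. by rewrite -row_permE mxE. Qed.

Lemma sorting_perm x :
  exists s : 'S_n, forall i j : 'I_n, (i <= j)%N -> x (s i) 0 <= x (s j) 0.
Proof.
pose t := [tuple x i 0 | i < n].
have /tuple_permP[s E] : perm_eq (sort_tuple <=%R t) t by rewrite perm_sort.
exists s => i j ij.
have tE k : x (s k) 0 = nth 0 (sort_tuple <=%R t) k.
  by rewrite E -tnth_nth !tnth_mktuple.
rewrite !tE; apply: (sorted_leq_nth (@le_trans _ _) (@lexx _ _)) => //.
- by apply: sort_sorted; exact: le_total.
- by rewrite inE size_tuple.
- by rewrite inE size_tuple.
Qed.

Definition mode_perm (s : 'S_n) : 'M[R]_(n + n) :=
  block_mx (perm_mx s)^T 0 0 (perm_mx s)^T.

Lemma perm_mxK (s : 'S_n) : perm_mx s *m (perm_mx s)^T = 1%:M :> 'M[R]_n.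
Proof. by rewrite tr_perm_mx -perm_mxM mulgV perm_mx1. Qed.

Lemma symplectic_mode_perm s : symplectic (mode_perm s).
Proof.
rewrite /symplectic /mode_perm /Jmx tr_block_mx !trmxK !linear0 !mulmx_block.
by rewrite !(mul0mx, mulmx0, add0r, addr0, mulmx1, mulmxN, mulNmx) perm_mxK.
Qed.

Lemma mode_perm_Dmx s x :
  (mode_perm s)^T *m Dmx x *m mode_perm s = Dmx (perm_mx s *m x).
Proof.
rewrite /mode_perm /Dmx tr_block_mx !trmxK !linear0 !mulmx_block.
rewrite !(mul0mx, mulmx0, add0r, addr0).
suff -> : perm_mx s *m diag_mx x^T *m (perm_mx s)^T = diag_mx (perm_mx s *m x)^T.
  by [].
apply/matrixP => i j; transitivity (x (s i) 0 *+ (s i == s j)).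
  by rewrite tr_perm_mx -col_permE -row_permE !mxE.
by rewrite (inj_eq perm_inj) -mul_perm_cV [RHS]mxE [in RHS]mxE.
Qed.

Lemma williamson A : positive_definite A -> exists x, is_symplectic_spectrum A x.
Proof.
move=> Apd; have [M [x [MJ MA]]] := williamson_unsorted Apd.
have x0 := Dmx_gt0_congr Apd MJ MA.
have [s xs] := sorting_perm x.
exists (perm_mx s *m x); split.
- by move=> i; rewrite mul_perm_cV.
- by move=> i j ij; rewrite !mul_perm_cV xs.
- exists (M *m mode_perm s); first exact/symplectic_mul/symplectic_mode_perm.
  by rewrite -mode_perm_Dmx -MA trmx_mul !mulmxA.
Qed.

Definition qf p (A : 'M[R]_p) (v : 'cV[R]_p) := (v^T *m A *m v) 0 0.

Lemma qf_congr p q (A : 'M[R]_p) (M : 'M[R]_(p, q)) v :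
  qf (M^T *m A *m M) v = qf A (M *m v).
Proof. by rewrite /qf trmx_mul !mulmxA. Qed.

Lemma qf_Dmx x v : qf (Dmx x) v = \sum_i dbl x 0 i * v i 0 ^+ 2.
Proof.
rewrite /qf -mulmxA mxE; apply: eq_bigr => i _.
by rewrite mul_Dmx mxE expr2 mulrCA mulrA.
Qed.

Lemma qf1 p (v : 'cV[R]_p) : qf 1%:M v = \sum_i v i 0 ^+ 2.
Proof. by rewrite /qf mulmx1 mxE; apply: eq_bigr => i _; rewrite mxE expr2. Qed.

Lemma qf_gram p q (M : 'M[R]_(p, q)) v :
  qf (M^T *m M) v = \sum_i (M *m v) i 0 ^+ 2.
Proof. by rewrite -[M^T]mulmx1 qf_congr qf1. Qed.

Lemma qfD p (A B : 'M[R]_p) v : qf (A + B) v = qf A v + qf B v.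
Proof. by rewrite /qf mulmxDr mulmxDl mxE. Qed.

Lemma qfZ p c (A : 'M[R]_p) v : qf (c *: A) v = c * qf A v.
Proof. by rewrite /qf -scalemxAr -scalemxAl mxE. Qed.

Lemma parallelogram_mx p (T T' D : 'M[R]_p) :
  (T - T')^T *m D *m (T - T') + (T + T')^T *m D *m (T + T') =
    2 *: (T^T *m D *m T + T'^T *m D *m T').
Proof.
rewrite ![(_ + _)^T]linearD linearN /= !(mulmxDl, mulmxDr, mulmxN, mulNmx, opprK).
move: (T^T *m D *m T) (T'^T *m D *m T) (T^T *m D *m T') (T'^T *m D *m T') => a b c d.
by apply/matrixP => i j; rewrite !mxE; ring.
Qed.

Lemma qf_sub p (A B : 'M[R]_p) v : qf (A - B) v = qf A v - qf B v.
Proof. by rewrite -scaleN1r qfD qfZ mulN1r. Qed.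

(* The parts [P] and [Q] of [T] that commute and anticommute with [J],
   doubled. *)
Lemma symplectic_split_form (T : 'M[R]_(n + n)) x :
  let P := T - J *m T *m J in let Q := T + J *m T *m J in
  P^T *m Dmx x *m P + Q^T *m Dmx x *m Q =
    2 *: (T^T *m Dmx x *m T + J^T *m (T^T *m Dmx x *m T) *m J).
Proof.
set T' := J *m T *m J => P Q.
have -> : J^T *m (T^T *m Dmx x *m T) *m J = T'^T *m Dmx x *m T'.
  rewrite /T' !trmx_mul -!mulmxA; do 2!congr (_ *m _).
  rewrite !mulmxA; do 2!congr (_ *m _).
  by rewrite -(mulmxA _ _ J) -Jmx_Dmx mulmxA tr_Jmx mulNmx mul_Jmx_Jmx opprK mul1mx.
exact: parallelogram_mx.
Qed.

(** The cross terms are [T^T J T J = J J = - 1] and its transpose. For the undoubled parts this is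
    the Bogoliubov relation [P^T P - Q^T Q = 1]. *)
Lemma symplectic_split_norm (T : 'M[R]_(n + n)) : symplectic T ->
  let P := T - J *m T *m J in let Q := T + J *m T *m J in
  P^T *m P - Q^T *m Q = 4 *: 1%:M.
Proof.
move=> TJ; set T' := J *m T *m J => P Q.
have TT' : T^T *m T' = - 1%:M by rewrite /T' !mulmxA TJ mul_Jmx_Jmx.
have T'T : T'^T *m T = - 1%:M.
  by rewrite -[LHS]trmxK trmx_mul trmxK TT' linearN /= trmx1.
rewrite /P /Q !linearD !linearN /= !(mulmxDl, mulmxDr, mulmxN, mulNmx, opprK).
rewrite TT' T'T.
move: (T^T *m T) (T'^T *m T') (1%:M) => a b c.
by apply/matrixP => i j; rewrite !mxE; ring.
Qed.

(* Weyl-type monotonicity. In the basis change [T] between the two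
   diagonalizations, counting dimensions gives a nonzero [u] supported on the
   modes [<= j] whose image under the [J]-commuting part of [T] is supported on
   the modes [>= j]. *)
Lemma symplectic_spectrum_le B C x y :
  is_symplectic_spectrum B x -> is_symplectic_spectrum C y ->
  (forall v, qf B v <= qf C v) -> forall j, x j 0 <= y j 0.
Proof.
move=> [x0 xs [N NJ NB]] [y0 ys [M MJ MC]] BC j.
have NM : N *m (invmx N *m M) = M by rewrite mulKVmx ?symplectic_unitmx.
set T := invmx N *m M in NM.
have TJ : symplectic T by apply: symplectic_mul => //; exact: symplectic_invmx.
have TD v : qf (T^T *m Dmx x *m T) v <= qf (Dmx y) v.
  by rewrite -MC !qf_congr -NM -mulmxA -[leRHS](qf_congr C) qf_congr -NB qf_congr.
set P := T - J *m T *m J; set Q := T + J *m T *m J.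
(* Rows of modes [< j] make [P u] vanish there, rows of modes [> j] make [u] vanish there, and the
   two rows of mode [j] are zero: at most [2 n - 2] conditions on [2 n] unknowns. *)
pose G : 'M[R]_(n + n) := \matrix_(i, k)
  if (mode i < j)%N then P i k else ((i == k) && (j < mode i)%N)%:R.
have /det0P[z z0 zG] : \det G^T == 0.
  rewrite det_tr (expand_det_row _ (lshift n j)) big1// => k _.
  by rewrite mxE mode_lshift ltnn andbF mul0r.
pose u := z^T.
have uG i : (G *m u) i 0 = 0.
  by rewrite -[G]trmxK -trmx_mul zG !mxE.
have u0 : 0 < qf 1%:M u.
  have [i ui] : exists i, u i 0 != 0.
    apply/existsP; apply: contraNT z0; rewrite negb_exists => /forallP u0.
    apply/eqP/rowP => i; have := u0 i; rewrite negbK !mxE => /eqP->.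
    by [].
  rewrite qf1 (bigD1 i)//= ltr_pwDl ?exprn_even_gt0//.
  by apply: sumr_ge0 => k _; exact: sqr_ge0.
have uj i : u i 0 != 0 -> (mode i <= j)%N.
  apply: contraNT; rewrite -ltnNge => ji; have := uG i.
  rewrite mxE (bigD1 i)//= big1 => [|k ki].
    by rewrite !mxE ltnNge (ltnW ji) /= eqxx ji mul1r addr0 => ->.
  by rewrite !mxE ltnNge (ltnW ji) /= eq_sym (negPf ki) mul0r.
have Pj i : (P *m u) i 0 != 0 -> (j <= mode i)%N.
  apply: contraNT; rewrite -ltnNge => ij; rewrite -(uG i) !mxE.
  by apply/eqP; apply: eq_bigr => k _; rewrite [G _ _]mxE ij.
have := symplectic_split_norm TJ.
have := symplectic_split_form T x.
rewrite -/P -/Q /= => /(congr1 (fun A => qf A u)) E1 /(congr1 (fun A => qf A u)) E2.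
have Ppart : x j 0 * qf (P^T *m P) u <= qf (P^T *m Dmx x *m P) u.
  rewrite qf_gram qf_congr qf_Dmx mulr_sumr ler_sum// => i _.
  have [->|Pi] := eqVneq ((P *m u) i 0) 0; first by rewrite expr0n !mulr0.
  by rewrite ler_wpM2r ?sqr_ge0// dblE xs// Pj.
have upart : qf (Dmx y) u <= y j 0 * qf 1%:M u.
  rewrite qf1 qf_Dmx mulr_sumr ler_sum// => i _.
  have [->|ui] := eqVneq (u i 0) 0; first by rewrite expr0n !mulr0.
  by rewrite ler_wpM2r ?sqr_ge0// dblE ys// uj.
have Jupart : qf (J^T *m (T^T *m Dmx x *m T) *m J) u <= qf (Dmx y) u.
  rewrite qf_congr (le_trans (TD _))// -qf_congr -mulmxA -Jmx_Dmx mulmxA.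
  by rewrite tr_Jmx mulNmx mul_Jmx_Jmx opprK mul1mx.
have Q0 : 0 <= qf (Q^T *m Dmx x *m Q) u.
  rewrite qf_congr qf_Dmx sumr_ge0// => i _.
  by rewrite mulr_ge0 ?sqr_ge0// ltW// dbl_gt0.
have Q1 : 0 <= qf (Q^T *m Q) u.
  rewrite qf_gram sumr_ge0// => i _.
  by rewrite sqr_ge0.
(* With the nonnegative [Q] terms dropped: [4 x_j |u|^2 <= x_j |P u|^2 <= (P u)^T D_x (P u) <= 4 u^T
   D_y u <= 4 y_j |u|^2]. *)
move: E1 E2; rewrite /= -[- _]scaleN1r !(qfD, qfZ).
move=> E1 /(congr1 ( *%R (x j 0))) E2.
have xQ := mulr_ge0 (ltW (x0 j)) Q1.
rewrite -(ler_pM2r u0); have := TD u; lra.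
Qed.

End Spectrum.

(** * Lipschitz continuity of the symplectic spectrum *)

Section SpectrumLipschitz.
Context {R : realType} {n : nat}.
Implicit Types (M A B C X Z W : 'M[R]_(n + n)) (x y w : 'cV[R]_n).
Local Notation J := (Jmx R n).
Local Notation spec := (@symplectic_spectrum R n).

Lemma symplectic_spectrum_unique A x y :
  is_symplectic_spectrum A x -> is_symplectic_spectrum A y -> x = y.
Proof.
move=> Ax Ay; apply/colP => j; apply/eqP; rewrite eq_le.
by rewrite (symplectic_spectrum_le Ax Ay) ?(symplectic_spectrum_le Ay Ax).
Qed.

Lemma symplectic_spectrum_eq A x : is_symplectic_spectrum A x -> spec A = x.
Proof.
move=> Ax; apply: xget_subset1 => //= y z; exact: symplectic_spectrum_unique.
Qed.

Lemma symplectic_spectrumP A : positive_definite A ->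
  is_symplectic_spectrum A (spec A).
Proof. by move=> /williamson[x Ax]; rewrite (symplectic_spectrum_eq Ax). Qed.

Lemma symplectic_spectrum_congr A M : symplectic M ->
  spec (M^T *m A *m M) = spec A.
Proof.
move=> MJ; rewrite /symplectic_spectrum; congr xget; apply/seteqP; split=> x.
  move=> [x0 xs [N NJ NA]]; split=> //; exists (M *m N).
    exact: symplectic_mul.
  by rewrite -NA trmx_mul !mulmxA.
move=> [x0 xs [N NJ NA]]; split=> //; exists (invmx M *m N).
  by apply: symplectic_mul => //; exact: symplectic_invmx.
rewrite -NA trmx_mul trmx_inv !mulmxA mulmxKV ?unitmx_tr ?symplectic_unitmx//.
by rewrite -(mulmxA _ M) mulmxV ?symplectic_unitmx// mulmx1.
Qed.

Lemma symplectic_spectrum_Dmx x : positive_vectors R n x ->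
  exists s : 'S_n, spec (Dmx x) = perm_mx s *m x.
Proof.
move=> x0; have [s xs] := sorting_perm x; exists s.
apply: symplectic_spectrum_eq; split.
- by move=> i; rewrite mul_perm_cV.
- by move=> i j ij; rewrite !mul_perm_cV xs.
- exists (mode_perm s); first exact: symplectic_mode_perm.
  exact: mode_perm_Dmx.
Qed.

Lemma spectral_function_Dmx (f : 'cV[R]_n -> R) x : symmetric_function f ->
  positive_vectors R n x -> f (spec (Dmx x)) = f x.
Proof.
by move=> fsym x0; have [s ->] := symplectic_spectrum_Dmx x0; rewrite fsym.
Qed.

Lemma is_symplectic_spectrum_scale c A x : 0 < c ->
  is_symplectic_spectrum A x -> is_symplectic_spectrum (c *: A) (c *: x).
Proof.
move=> c0 [x0 xs [M MJ MA]]; split.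
- by move=> i; rewrite mxE mulr_gt0.
- by move=> i j ij; rewrite !mxE ler_pM2l// xs.
- exists M => //; rewrite -scalemxAr -scalemxAl MA.
  apply/matrixP => i j; rewrite mxE !DmxE !dblE mxE; exact: mulrnAr.
Qed.

Lemma norm_qf_le p (A : 'M[R]_p) v : `|qf A v| <= p%:R ^+ 2 * `|A| * `|v| ^+ 2.
Proof.
rewrite (le_trans (le_coord_norm _ _ _))// (le_trans (norm_mulmx_le _ _))//.
have := norm_mulmx_le v^T A; rewrite norm_trmx => vA.
have -> : p%:R ^+ 2 * `|A| * `|v| ^+ 2 = p%:R * ((p%:R * (`|v| * `|A|)) * `|v|).
  by ring.
by rewrite ler_wpM2l// ler_wpM2r.
Qed.

(** Coercivity near [A] turns an additive perturbation into a multiplicative one,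
    [C <= (1 + K |B - C|) B] as forms; monotonicity and homogeneity carry this over to the spectra.
    The columns of a diagonalizing [M] are bounded because the form of [B] takes on them the bounded
    values [d_j(B)]. *)
Lemma symplectic_spectrum_lipschitz A : positive_definite A ->
  exists r c : R, [/\ 0 < r, 0 < c &
    (forall B C, B^T = B -> C^T = C -> `|B - A| < r -> `|C - A| < r ->
      [/\ positive_definite B, `|spec B - spec C| <= c * `|B - C| &
        forall M, SPup B M -> `|M| <= c])].
Proof.
move=> Apd; have [Asym A0] := Apd; have [m m0 Am] := definite_coercive A0.
pose k : R := (n + n)%:R ^+ 2 + 1.
have k0 : 0 < k by rewrite ltr_wpDl// sqr_ge0.
pose r := m / (2 * k); have r0 : 0 < r by rewrite divr_gt0// mulr_gt0.
have qfB B v : `|B - A| < r -> m / 2 * `|v| ^+ 2 <= qf B v.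
  move=> BA; have /ler_normlP[] := norm_qf_le (B - A) v.
  rewrite qf_sub; have := Am v; rewrite -/(qf A v).
  have : (n + n)%:R ^+ 2 * `|B - A| * `|v| ^+ 2 <= m / 2 * `|v| ^+ 2.
    rewrite ler_wpM2r ?sqr_ge0//.
    have -> : m / 2 = k * r by rewrite /r; field; rewrite gt_eqF.
    by rewrite ler_pM// ?sqr_ge0 ?ltW// ltrDl.
  lra.
have Bpd B : B^T = B -> `|B - A| < r -> positive_definite B.
  move=> Bsym BA; split=> // v v0; apply: lt_le_trans (qfB _ _ BA).
  by rewrite mulr_gt0 ?divr_gt0// exprn_gt0// normr_gt0.
pose K := 2 * k / m; have K0 : 0 < K by rewrite divr_gt0// mulr_gt0.
have half B C j : B^T = B -> C^T = C -> `|B - A| < r -> `|C - A| < r ->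
    spec C j 0 <= (1 + K * `|B - C|) * spec B j 0.
  move=> Bsym Csym BA CA.
  have d0 : 0 < 1 + K * `|B - C| by rewrite ltr_pwDl// mulr_ge0// ltW.
  have := is_symplectic_spectrum_scale d0 (symplectic_spectrumP (Bpd _ Bsym BA)).
  have := symplectic_spectrumP (Bpd _ Csym CA).
  move=> Cs /(symplectic_spectrum_le Cs) CB.
  have := CB _ j; rewrite mxE; apply=> v; rewrite qfZ mulrDl mul1r.
  have /ler_normlP[_] := norm_qf_le (C - B) v; rewrite qf_sub distrC.
  have : (n + n)%:R ^+ 2 * `|B - C| * `|v| ^+ 2 <= K * `|B - C| * qf B v.
    have -> : K * `|B - C| * qf B v = k * `|B - C| * (2 / m * qf B v).
      by rewrite /K; field; rewrite gt_eqF.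
    rewrite ler_pM ?mulr_ge0 ?sqr_ge0// ?ler_wpM2r ?lerDl//.
    have := qfB B v BA; rewrite -(ler_pM2l (_ : 0 < 2 / m)) ?divr_gt0//.
    by congr (_ <= _); field; rewrite gt_eqF.
  lra.
have rA : `|A - A| < r by rewrite subrr normr0.
pose d := (1 + K * r) * `|spec A|.
have d0 : 0 <= d by rewrite mulr_ge0// addr_ge0// mulr_ge0// ltW.
have specd B j : B^T = B -> `|B - A| < r -> 0 < spec B j 0 <= d.
  move=> Bsym BA; have [B0 _ _] := symplectic_spectrumP (Bpd _ Bsym BA).
  rewrite B0 (le_trans (half _ _ j Asym Bsym rA BA))//.
  have [a0 _ _] := symplectic_spectrumP Apd.
  apply: ler_pM.
  - by apply: addr_ge0 => //; apply: mulr_ge0 => //; exact: ltW.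
  - exact: ltW.
  - by rewrite lerD2l; apply: ler_wpM2l; [exact: ltW|rewrite distrC ltW].
  - exact: le_trans (ler_norm _) (le_coord_norm _ j 0).
have c10 : 0 <= K * d := mulr_ge0 (ltW K0) d0.
have c20 : 0 <= 2 * d / m := divr_ge0 (mulr_ge0 (ler0n _ 2) d0) (ltW m0).
(* One constant serves both bounds: [K d] for the spectrum, and [1 + 2 d / m] for [M], since
   [M_ij^2 <= 2 d / m]. *)
exists r, (1 + K * d + 2 * d / m); split=> //.
  by rewrite -addrA ltr_pwDl// addr_ge0.
move=> B C Bsym Csym BA CA; split; first exact: Bpd.
- apply: norm_mx_le => [|j i]; first by rewrite mulr_ge0// !addr_ge0.
  rewrite ord1 !mxE.
  have := half _ _ j Bsym Csym BA CA; have := half _ _ j Csym Bsym CA BA.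
  have := specd B j Bsym BA; have := specd C j Csym CA; rewrite [`|C - B|]distrC.
  move=> /andP[C0 Cd] /andP[B0 Bd] h1 h2.
  have e1 : K * `|B - C| * spec C j 0 <= K * d * `|B - C|.
    by rewrite mulrAC ler_wpM2r// ler_pM2l.
  have e2 : K * `|B - C| * spec B j 0 <= K * d * `|B - C|.
    by rewrite mulrAC ler_wpM2r// ler_pM2l.
  have e3 : 0 <= 2 * d / m * `|B - C| by rewrite mulr_ge0.
  have e4 := normr_ge0 (B - C).
  by apply/ler_normlP; split; lra.
- move=> M [MJ MB]; apply: norm_mx_le => [|i j]; first by rewrite !addr_ge0.
  have : m / 2 * `|M i j| ^+ 2 <= d.
    have /andP[_ Bd] := specd B (mode j) Bsym BA.
    apply: le_trans Bd; rewrite -dblE.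
    have -> : dbl (spec B) 0 j = (M^T *m B *m M) j j by rewrite MB DmxE eqxx.
    rewrite congr_diag; apply: le_trans (qfB _ _ BA).
    apply: ler_wpM2l; first exact: divr_ge0 (ltW m0) (ler0n _ 2).
    rewrite lerXn2r ?nnegrE//.
    by have := le_coord_norm (col j M) i 0; rewrite mxE.
  rewrite -(ler_pM2l (_ : 0 < 2 / m)) ?divr_gt0// mulrA.
  have -> : 2 / m * (m / 2) = 1 by field; rewrite gt_eqF.
  rewrite mul1r mulrAC => h; have := normr_ge0 (M i j); nra.
Qed.

End SpectrumLipschitz.

(** * Simultaneous diagonalization in the stabilizer *)

Section Codiagonalization.
Context {R : realType}.

Lemma norm_mulmx_bound p q r (A : 'M[R]_(p, q)) (B : 'M[R]_(q, r)) a b :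
  `|A| <= a -> `|B| <= b -> `|A *m B| <= q%:R * (a * b).
Proof.
move=> Aa Bb; rewrite (le_trans (norm_mulmx_le _ _))// ler_wpM2l//.
by rewrite ler_pM.
Qed.

Lemma orthogonal_norm_le1 p (Q : 'M[R]_p) : Q^T *m Q = 1%:M -> `|Q| <= 1.
Proof.
move=> /matrixP QQ; apply: norm_mx_le => // i j.
have : Q i j ^+ 2 <= 1.
  have := QQ j j; rewrite !mxE eqxx mulr1n => <-.
  rewrite (bigD1 i)//= mxE -expr2 lerDl; apply: sumr_ge0 => k _.
  by rewrite mxE -expr2 sqr_ge0.
by rewrite -[_ ^+ 2]ger0_norm ?sqr_ge0// normrX expr_le1.
Qed.

(** * The Cayley transform of a skew matrix *)

Section Cayley.
Context {p : nat} (X : 'M[R]_p) (t : R).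
Hypothesis Xskew : X^T = - X.

(** A row vector in the kernel satisfies [v = t v X], so [v v^T = t v X v^T], which is zero for skew
    [X]. *)
Lemma cayley_unitmx : 1%:M - t *: X \in unitmx.
Proof.
rewrite unitmxE unitfE; apply/negP => /det0P[v v0].
rewrite mulmxBr mulmx1 => /subr0_eq vE.
have vXv : v *m X *m v^T = 0.
  apply/matrixP => i j; rewrite !ord1 [RHS]mxE.
  have : (v *m X *m v^T)^T 0 0 = (v *m X *m v^T) 0 0 by rewrite mxE.
  by rewrite !trmx_mul trmxK Xskew mulNmx mulmxN mulmxA mxE; lra.
have : v *m v^T = 0 by rewrite {1}vE -scalemxAr -scalemxAl vXv scaler0.
move=> /(congr1 mxtrace); rewrite mxtrace_mulC mxtrace0 => vv.
case/negP: v0; apply/eqP; apply: frobenius_dot_eq0.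
by rewrite /frobenius_dot vv.
Qed.

Definition cayley := invmx (1%:M - t *: X) *m (1%:M + t *: X).
(** The exact difference quotient [(cayley - 1) / t], not the derivative; its implicit equation
    below bounds it uniformly for small [t]. *)
Definition cayley_velocity := invmx (1%:M - t *: X) *m (2 *: X).

Lemma cayleyE : cayley = 1%:M + t *: cayley_velocity.
Proof.
rewrite /cayley /cayley_velocity.
have -> : 1%:M + t *: X = (1%:M - t *: X) + t *: (2 *: X).
  by apply/matrixP => i j; rewrite !mxE; ring.
by rewrite mulmxDr mulVmx ?cayley_unitmx// scalemxAr.
Qed.

Lemma cayley_velocityE : cayley_velocity = 2 *: X + t *: (X *m cayley_velocity).
Proof.
apply/eqP; rewrite -subr_eq; apply/eqP.
transitivity ((1%:M - t *: X) *m cayley_velocity).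
  by rewrite mulmxBl mul1mx -scalemxAl.
by rewrite mulKVmx ?cayley_unitmx.
Qed.

Lemma cayley_orthogonal : cayley^T *m cayley = 1%:M.
Proof.
have tr1 : (1%:M + t *: X)^T = 1%:M - t *: X.
  by rewrite linearD linearZ /= trmx1 Xskew scalerN.
have tr2 : (1%:M - t *: X)^T = 1%:M + t *: X by rewrite -tr1 trmxK.
have u1 := cayley_unitmx.
have u2 : 1%:M + t *: X \in unitmx by rewrite -tr2 unitmx_tr.
rewrite /cayley trmx_mul trmx_inv tr1 tr2 !mulmxA.
have C : (1%:M + t *: X) *m (1%:M - t *: X) = (1%:M - t *: X) *m (1%:M + t *: X).
  rewrite !(mulmxDl, mulmxDr, mulmxN, mulNmx, mul1mx, mulmx1).
  by apply/matrixP => i j; rewrite !mxE; ring.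
have -> : (1%:M - t *: X) *m invmx (1%:M + t *: X) =
    invmx (1%:M + t *: X) *m (1%:M - t *: X).
  apply: (can_inj (mulKmx u2)); apply: (can_inj (mulmxK u2)).
  by rewrite mulKVmx// -!mulmxA mulVmx// mulmx1 C.
by rewrite mulmxK// mulVmx.
Qed.

Lemma cayley_commute (B : 'M[R]_p) : X *m B = B *m X -> cayley *m B = B *m cayley.
Proof.
move=> XB.
have C (s : R) : (1%:M + s *: X) *m B = B *m (1%:M + s *: X).
  by rewrite mulmxDl mulmxDr mul1mx mulmx1 -scalemxAl XB scalemxAr.
have u1 := cayley_unitmx; apply: (can_inj (mulKmx u1)).
have C' := C (- t); rewrite scaleNr in C'.
by rewrite /cayley -mulmxA mulKVmx// C !mulmxA C' -!mulmxA mulKVmx.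
Qed.

End Cayley.

Context {n : nat}.
Implicit Types (Q Z : 'M[R]_(n + n)) (x y w : 'cV[R]_n).
Local Notation J := (Jmx R n).

(** Transposition gives [tr (Z D X) = - tr (D Z X)], as the commutator [X] is skew; hence
    [tr (X X) = 2 tr (D Z X)]. *)
Lemma mxtrace_commutator p (D Z X : 'M[R]_p) : D^T = D -> Z^T = Z ->
  X = D *m Z - Z *m D -> 2 * \tr (D *m (Z *m X)) = - frobenius_dot X X.
Proof.
move=> DD ZZ XE.
have Xskew : X^T = - X.
  by rewrite XE linearD linearN /= !trmx_mul DD ZZ opprB.
rewrite /frobenius_dot Xskew mulNmx linearN /= opprK {2}XE mulmxBl linearB /=.
have -> : \tr (Z *m D *m X) = - \tr (D *m (Z *m X)).
  rewrite -[LHS]mxtrace_tr !trmx_mul DD ZZ Xskew mulNmx linearN /=.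
  by rewrite mxtrace_mulC mulmxA.
rewrite mulmxA; ring.
Qed.

(* At a minimizer [Q] of [tr (D_w Q^T Z Q)] the derivative along the Cayley
   curve of [X = [D_w, Q^T Z Q]] is [- 2 |X|^2], so that [X = 0]. *)
Lemma codiagonalization x Z : Z^T = Z -> Z *m J = J *m Z ->
  Z *m Dmx x = Dmx x *m Z ->
  exists Q y, [/\ Q^T *m Q = 1%:M, Q *m J = J *m Q,
    Q *m Dmx x = Dmx x *m Q & Q^T *m Z *m Q = Dmx y].
Proof.
move=> Zsym ZJ ZD.
pose w : 'cV[R]_n := \col_i i.+1%:R.
pose F Q := \tr (Dmx w *m (Q^T *m Z *m Q)).
pose K := [set Q | Q^T *m Q = 1%:M] `&` ([set Q | Q *m J = J *m Q] `&`
  [set Q | Q *m Dmx x = Dmx x *m Q]).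
have cl (B : 'M[R]_(n + n)) : continuous (mulmx B).
  move=> Q; apply: (@cvg_mulmx _ _ (nbhs Q)); [exact: cvg_cst|exact: cvg_id].
have cr (B : 'M[R]_(n + n)) : continuous (fun Q => Q *m B).
  move=> Q; apply: (@cvg_mulmx _ _ (nbhs Q)); [exact: cvg_id|exact: cvg_cst].
have Kcl : closed K.
  apply: closedI; last apply: closedI.
  - apply: closed_eq_continuous; last exact: cst_continuous.
    move=> Q; apply: (@cvg_mulmx _ _ (nbhs Q)); last exact: cvg_id.
    exact: trmx_continuous.
  - by apply: closed_eq_continuous; [exact: cr|exact: cl].
  - by apply: closed_eq_continuous; [exact: cr|exact: cl].
have cF : continuous F.
  move=> Q; apply: (@cvg_mxtrace _ _ (nbhs Q)).
  apply: (@cvg_mulmx _ _ (nbhs Q)); first exact: cvg_cst.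
  apply: (@cvg_mulmx _ _ (nbhs Q)); last exact: cvg_id.
  apply: (@cvg_mulmx _ _ (nbhs Q)); last exact: cvg_cst.
  exact: trmx_continuous.
have K1 : K 1%:M by split; [|split]; rewrite /= ?trmx1 ?mul1mx ?mulmx1.
have [|Q [QQ [QJ QD]] Qmin] := @closed_min_mx _ _ _ _ F 1 _ Kcl cF K1.
  by move=> Q [/orthogonal_norm_le1].
pose Z' := Q^T *m Z *m Q; have Z'E : Q^T *m Z *m Q = Z' by [].
have Z'sym : Z'^T = Z' by rewrite /Z' !trmx_mul trmxK Zsym mulmxA.
have Qt B : B^T = B \/ B^T = - B -> Q *m B = B *m Q -> Q^T *m B = B *m Q^T.
  move=> Bs QB; have := congr1 trmx QB; rewrite !trmx_mul.
  case: Bs => ->; first by move->.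
  by rewrite mulNmx mulmxN => /oppr_inj ->.
have com B : B^T = B \/ B^T = - B -> Q *m B = B *m Q -> Z *m B = B *m Z ->
    Z' *m B = B *m Z'.
  move=> Bs QB ZB; rewrite /Z' -mulmxA QB mulmxA -(mulmxA Q^T) ZB.
  by rewrite !mulmxA Qt.
have Z'J := com J (or_intror (tr_Jmx)) QJ ZJ.
have Z'D := com (Dmx x) (or_introl (tr_Dmx x)) QD ZD.
clearbody Z'.
pose X := Dmx w *m Z' - Z' *m Dmx w; have XE : X = Dmx w *m Z' - Z' *m Dmx w by [].
have Xskew : X^T = - X.
  by rewrite /X linearD linearN /= !trmx_mul tr_Dmx Z'sym opprB.
have XB B : Z' *m B = B *m Z' -> Dmx w *m B = B *m Dmx w -> X *m B = B *m X.
  move=> ZB wB; rewrite /X mulmxBl mulmxBr -!mulmxA ZB wB !mulmxA ZB wB.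
  by rewrite -?mulmxA.
have XJ : X *m J = J *m X by apply: XB => //; rewrite Jmx_Dmx.
have XD : X *m Dmx x = Dmx x *m X.
  by apply: XB => //; rewrite !Dmx_diag; exact: diag_mxC.
have trX := mxtrace_commutator (tr_Dmx w) Z'sym XE.
clearbody X.
have X0 : X = 0.
  apply: frobenius_dot_eq0.
  (* [G] collects the terms of order [t^2] in the variation of [F]; [c] bounds it for velocities of
     norm at most [v]. *)
  pose G V := 2 * \tr (Dmx w *m (Z' *m (X *m V))) +
    \tr (Dmx w *m (V^T *m Z' *m V)).
  pose N : R := (n + n)%:R.
  pose v := 4 * `|X|.
  pose c := 2 * (N * (N * (`|Dmx w| * (N * (`|Z'| * (N * (`|X| * v))))))) +
            N * (N * (`|Dmx w| * (N * (N * (v * `|Z'|) * v)))).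
  have GV V : `|V| <= v -> `|G V| <= c.
    move=> Vv; rewrite (le_trans (ler_normD _ _))// lerD//.
      rewrite normrM (ger0_norm (ler0n _ 2)) ler_wpM2l//.
      rewrite (le_trans (norm_mxtrace_le _))// ler_wpM2l//.
      by do 3!apply: norm_mulmx_bound => //.
    rewrite (le_trans (norm_mxtrace_le _))// ler_wpM2l//.
    do 3!apply: norm_mulmx_bound => //.
    by rewrite norm_trmx.
  (* For [t <= t0] the velocity equation gives [|V| <= 2 |X| + |V| / 2], hence [v = 4 |X|]. *)
  clearbody c; pose t0 := (2 * N * `|X| + 1)^-1.
  have t00 : 0 < t0 by rewrite invr_gt0 ltr_wpDl// !mulr_ge0.
  have step t : 0 < t -> t <= t0 -> 0 <= - 2 * frobenius_dot X X + t * c.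
    move=> tgt0 tt0; have VE := cayley_velocityE t Xskew.
    have CE := cayleyE t Xskew; have CO := cayley_orthogonal t Xskew.
    have CJ := cayley_commute t Xskew XJ; have CD := cayley_commute t Xskew XD.
    move: (cayley X t) (cayley_velocity X t) VE CE CO CJ CD => C V VE CE CO CJ CD.
    have Vv : `|V| <= v.
      have : `|V| <= 2 * `|X| + t * (N * (`|X| * `|V|)).
        rewrite {1}VE (le_trans (ler_normD _ _))// lerD//.
          by rewrite normrZ ger0_norm.
        by rewrite normrZ gtr0_norm// ler_pM2l// norm_mulmx_le.
      have : t * (2 * N * `|X| + 1) <= 1.
        by rewrite -ler_pdivlMr ?mul1r// -invr_gt0.
      have := normr_ge0 V; have := normr_ge0 X; rewrite /v; nra.
    have KC : K (Q *m C).
      split; [|split] => /=.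
      - by rewrite trmx_mul !mulmxA -(mulmxA _ Q^T) QQ mulmx1.
      - by rewrite -mulmxA CJ mulmxA QJ mulmxA.
      - by rewrite -mulmxA CD mulmxA QD mulmxA.
    have := Qmin _ KC; rewrite /F trmx_mul.
    have -> : C^T *m Q^T *m Z *m (Q *m C) = C^T *m Z' *m C.
      by rewrite -Z'E !mulmxA.
    rewrite Z'E CE [(1%:M + _)^T]linearD /= [(t *: V)^T]linearZ /= trmx1.
    rewrite mulmxDl mul1mx !mulmxDr !mulmx1 -!scalemxAr -!scalemxAl !mulmxDr.
    rewrite -!scalemxAr !linearD /= !linearZ /= mxtrace_sym_swap ?tr_Dmx//.
    rewrite (mulmxDl Z') -scalemxAl mulmxDr -scalemxAr linearD linearZ /=.
    have -> : \tr (Dmx w *m (Z' *m V)) =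
        2 * \tr (Dmx w *m (Z' *m X)) + t * \tr (Dmx w *m (Z' *m (X *m V))).
      by rewrite {1}VE !mulmxDr -!scalemxAr linearD !linearZ.
    have := GV _ Vv; rewrite /G => /ler_normlP[_]; rewrite -subr_ge0 => h1 h2.
    rewrite -(pmulr_rge0 _ tgt0).
    have := mulr_ge0 (sqr_ge0 t) h1; have := congr1 ( *%R t) trX.
    move: h2; lra.
  have c0 : 0 <= c by apply: le_trans (GV 0 _); rewrite // normr0 mulr_ge0.
  have : 0 <= frobenius_dot X X := frobenius_dot_ge0 X.
  rewrite le_eqVlt => /orP[/eqP<-//|X0].
  pose t := Num.min t0 (frobenius_dot X X / (c + 1)).
  have c1 : 0 < c + 1 by rewrite ltr_wpDl.
  have tgt0 : 0 < t by rewrite lt_min t00 divr_gt0.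
  have tt0 : t <= t0 by rewrite ge_min lexx.
  have : t * (c + 1) <= frobenius_dot X X.
    by rewrite -ler_pdivlMr// ge_min lexx orbT.
  have := step t tgt0 tt0; nra.
have [| |y Z'y] := @eq_Dmx_of_commute _ _ w Z' _ Z'sym Z'J.
- by move=> i j; rewrite !mxE => /eqP; rewrite eqr_nat eqSS => /eqP/val_inj.
- by apply/esym/eqP; rewrite -subr_eq0 -XE X0.
by exists Q, y; split=> //; rewrite Z'E.
Qed.

End Codiagonalization.

(** * Clarke derivatives without limits superior *)

Section Clarke.
Context {R : realType} {p q : nat}.
Implicit Types (E : set 'M[R]_(p, q)) (phi : 'M[R]_(p, q) -> R).
Implicit Types (x y u v : 'M[R]_(p, q)) (a b : R).

(** The limit superior is the infimum of the [a] for which this holds; a single radius for base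
    points and steps replaces the product filter. *)
Definition clarke_bound E phi x u a :=
  exists2 e : R, 0 < e & forall y t, E y -> `|y - x| < e -> 0 < t < e ->
    phi (y + t *: u) - phi y <= t * a.

Lemma clarke_derivative_le E phi x u a :
  clarke_bound E phi x u a -> (clarke_derivative E phi x u <= a%:E)%E.
Proof.
move=> [e e0 phie].
pose V : set ('M[R]_(p, q) * R) :=
  [set y | E y /\ `|y - x| < e] `*` [set t | 0 < t < e].
apply: ge_ereal_inf.
exists (ereal_sup [set ((phi (yt.1 + yt.2 *: u) - phi yt.1) / yt.2)%:E | yt in V]).
  exists V => //; exists ([set y | E y /\ `|y - x| < e], [set t | 0 < t < e]) => //=.
  split => /=.
    apply/nbhs_ballP; exists e => //= y; rewrite -ball_normE /= => xy Ey.
    by rewrite distrC.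
  near=> t; apply/andP; split; near: t; first exact: nbhs_right_gt.
  exact: nbhs_right_lt.
apply: ge_ereal_sup => _ [[y t] [[/= Ey yx] /andP[t0 te]] <-].
by rewrite lee_fin ler_pdivrMr// mulrC phie// t0.
Unshelve. all: by end_near. Qed.

Lemma clarke_derivative_lt E phi x u a : (clarke_derivative E phi x u < a%:E)%E ->
  exists2 b, b < a & clarke_bound E phi x u b.
Proof.
move=> /ereal_inf_lt[_ [V [[P Q] [/= PE Q0] PQV] <-] supa].
have [b ba bsup] : exists2 b, b < a &
    (ereal_sup [set ((phi (yt.1 + yt.2 *: u) - phi yt.1) / yt.2)%:E | yt in V]
      <= b%:E)%E.
  move: supa; case: ereal_sup => [s| |] //; first by rewrite lte_fin; exists s.
  by exists (a - 1); rewrite ?leNye// gtrBl.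
exists b => //.
move: PE => /nbhs_ballP[e1 /= e10 e1P].
move: Q0; rewrite /at_right /within /= => /nbhs_ballP[e2 /= e20 e2Q].
exists (Num.min e1 e2); first by rewrite lt_min e10.
move=> y t Ey; rewrite !lt_min => /andP[ye _] /andP[t0 /andP[_ te]].
rewrite mulrC -ler_pdivrMr// -lee_fin; apply: le_trans bsup.
apply: ereal_sup_ubound; exists (y, t) => //.
apply: PQV; split => /=.
  by apply: e1P => //; rewrite -ball_normE /= distrC.
by apply: e2Q => //; rewrite /ball /= sub0r normrN gtr0_norm.
Qed.

Lemma clarke_gradientP E phi x y : clarke_gradient E phi x y <->
  E y /\ forall u a, E u -> clarke_bound E phi x u a -> frobenius_dot y u <= a.
Proof.
split=> -[Ey yP]; split=> // u.
  move=> a Eu /clarke_derivative_le ua; rewrite -lee_fin.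
  exact: le_trans (yP _ Eu) ua.
move=> Eu; rewrite leNgt; apply/negP => /clarke_derivative_lt[b ba /(yP _ _ Eu)].
by rewrite leNgt ba.
Qed.

(** The increment is split at [y + t u], itself a base point of [E] near [x]: letting the base point
    vary is what makes the Clarke derivative subadditive. *)
Lemma clarke_boundD E phi x u v a b : (forall y t, E y -> E (y + t *: u)) ->
  clarke_bound E phi x u a -> clarke_bound E phi x v b ->
  clarke_bound E phi x (u + v) (a + b).
Proof.
move=> Eu [e e0 phiu] [d d0 phiv].
have u1 : 0 < 1 + `|u| by rewrite ltr_pwDl.
pose r := Num.min e (d / 2 / (1 + `|u|)); exists r.
  by rewrite lt_min e0 !divr_gt0.
have rd : r <= d / 2.
  rewrite ge_min; apply/orP; right; rewrite ler_pdivrMr// ler_peMr ?lerDl//.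
  by rewrite divr_ge0// ltW.
have ru : r * (1 + `|u|) <= d / 2 by rewrite -ler_pdivlMr// ge_min lexx orbT.
have re : r <= e by rewrite ge_min lexx.
move=> y t Ey yx /andP[t0 tr].
have h1 : phi (y + t *: u) - phi y <= t * a.
  by apply: phiu => //; rewrite ?t0 /= (lt_le_trans _ re).
have h2 : phi (y + t *: u + t *: v) - phi (y + t *: u) <= t * b.
  apply: phiv; first exact: Eu.
    have : `|y + t *: u - x| <= `|y - x| + t * `|u|.
      by rewrite addrAC (le_trans (ler_normD _ _))// normrZ gtr0_norm.
    have := ler_wpM2r (normr_ge0 u) (ltW tr); lra.
  rewrite t0 (lt_le_trans tr)// (le_trans rd)// ler_pdivrMr//.
  by rewrite ler_peMr ?ler1n// ltW.
rewrite scalerDr addrA; lra.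
Qed.

Lemma clarke_boundZ E phi x u a c : 0 < c ->
  clarke_bound E phi x u a -> clarke_bound E phi x (c *: u) (c * a).
Proof.
move=> c0 [e e0 phiu]; exists (Num.min e (e / c)).
  by rewrite lt_min e0 divr_gt0.
move=> y t Ey; rewrite !lt_min => /andP[ye _] /andP[t0 /andP[_ te]].
rewrite scalerA mulrA; apply: phiu => //.
by rewrite mulr_gt0//= -ltr_pdivlMr.
Qed.

End Clarke.

(** * Averaging over the stabilizer *)

Section SpectralFunction.
Context {R : realType} {n : nat}.
Implicit Types (M A B G H Q Z : 'M[R]_(n + n)) (x y z w d g : 'cV[R]_n).
Local Notation J := (Jmx R n).
Local Notation spec := (@symplectic_spectrum R n).
Local Notation Sym := (symmetric_matrices R (n + n)).

Lemma sym_congr M A : Sym A -> Sym (M^T *m A *m M).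
Proof.
by rewrite /symmetric_matrices /= => AA; rewrite !trmx_mul trmxK AA mulmxA.
Qed.

Lemma symD A B : Sym A -> Sym B -> Sym (A + B).
Proof. by rewrite /symmetric_matrices /= => AA BB; rewrite linearD /= AA BB. Qed.

Lemma symZ c A : Sym A -> Sym (c *: A).
Proof. by rewrite /symmetric_matrices /= => AA; rewrite linearZ /= AA. Qed.

Lemma sym_Dmx x : Sym (Dmx x).
Proof. exact: tr_Dmx. Qed.

Lemma frobenius_dot_congr A H M :
  frobenius_dot (M *m A *m M^T) H = frobenius_dot A (M^T *m H *m M).
Proof.
by rewrite /frobenius_dot !trmx_mul trmxK -!mulmxA mxtrace_mulC !mulmxA.
Qed.

Lemma frobenius_dot_Dmx x G :
  frobenius_dot (Dmx x) G = \sum_i x i 0 *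
    (G (lshift n i) (lshift n i) + G (rshift n i) (rshift n i)).
Proof.
rewrite /frobenius_dot tr_Dmx /mxtrace big_split_ord /= -big_split /=.
apply: eq_bigr => i _.
by rewrite !mul_Dmx dbl_lshift dbl_rshift mulrDr.
Qed.

Lemma frobenius_dot_Dmx_Dmx x y :
  frobenius_dot (Dmx x) (Dmx y) = 2 * frobenius_dot x y.
Proof.
rewrite frobenius_dot_Dmx frobenius_dotE big_ord1 mulr_sumr; apply: eq_bigr => i _.
by rewrite !DmxE !eqxx dbl_lshift dbl_rshift !mulr1n; ring.
Qed.

Lemma DmxD x y : Dmx (x + y) = Dmx x + Dmx y.
Proof.
apply/matrixP => i j; rewrite [RHS]mxE !DmxE -mulrnDl !dblE.
by congr (_ *+ _); rewrite mxE.
Qed.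

Lemma DmxZ c x : Dmx (c *: x) = c *: Dmx x.
Proof.
apply/matrixP => i j; rewrite [RHS]mxE !DmxE !dblE mulrnAr.
by congr (_ *+ _); rewrite mxE.
Qed.

Lemma norm_Dmx x : `|Dmx x| = `|x|.
Proof.
apply/eqP; rewrite eq_le; apply/andP; split.
  apply: norm_mx_le => // i j; rewrite DmxE dblE.
  by case: (i == j); rewrite ?normr0// le_coord_norm.
apply: norm_mx_le => // i j; rewrite ord1.
have := le_coord_norm (Dmx x) (lshift n i) (lshift n i).
by rewrite DmxE eqxx dbl_lshift.
Qed.

Lemma positive_vectors_near d : positive_vectors R n d ->
  exists2 m : R, 0 < m & forall y, `|y - d| < m -> positive_vectors R n y.
Proof.
move=> d0; exists (\big[Num.min/1]_i d i 0); first by apply/bigmin_gtP; split.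
move=> y /bigmin_gtP[_ yd] i.
have := le_lt_trans (le_coord_norm (y - d) i 0) (yd i isT).
by rewrite !mxE ltr_norml => /andP[]; lra.
Qed.

Section Bounds.
Variable f : 'cV[R]_n -> R.
Hypothesis f_sym : symmetric_function f.
Local Notation phi := (fun B => f (spec B)).

(** [phi] is invariant under congruence, so base points can be pulled back along [N = M^-1]; [c]
    bounds this linear map and shrinks the radius accordingly. *)
Lemma spectral_clarke_bound_congr A H a M : symplectic M ->
  clarke_bound Sym phi A H a ->
  clarke_bound Sym phi (M^T *m A *m M) (M^T *m H *m M) a.
Proof.
move=> MJ [e e0 phie]; have Mu := symplectic_unitmx MJ.
pose N := invmx M; pose c := (n + n)%:R * ((n + n)%:R * (`|N| * 1) * `|N|) + 1.
have c0 : 0 < c by rewrite ltr_wpDl// !mulr_ge0.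
have MNK B : N^T *m (M^T *m B *m M) *m N = B.
  by rewrite !mulmxA -trmx_mul mulmxV// trmx1 mul1mx mulmxK.
have NMK B : M^T *m (N^T *m B *m N) *m M = B.
  by rewrite !mulmxA -trmx_mul mulVmx// trmx1 mul1mx mulmxKV.
exists (Num.min e (e / c)); first by rewrite lt_min e0 divr_gt0.
move=> y t ysym; rewrite !lt_min => /andP[_ yA] /andP[t0 /andP[te _]].
rewrite -[y]NMK scalemxAl scalemxAr -!mulmxDl -!mulmxDr.
rewrite !(symplectic_spectrum_congr _ MJ).
apply: phie; rewrite ?t0//; first exact: sym_congr.
rewrite -[A]MNK -mulmxBl -mulmxBr.
set B := y - _ in yA *.
rewrite (le_lt_trans (norm_mulmx_bound (norm_mulmx_le _ _) (lexx _)))//.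
move: yA; rewrite ltr_pdivlMr//; apply: le_lt_trans.
rewrite norm_trmx /c mulrDr mulr1 -[leLHS]addr0 lerD//.
by rewrite le_eqVlt; apply/orP; left; apply/eqP; ring.
Qed.

Lemma spectral_clarke_bound_average A H a Q : symplectic Q ->
  Q^T *m A *m Q = A -> Sym H ->
  clarke_bound Sym phi A H a ->
  clarke_bound Sym phi A (2^-1 *: (H + Q^T *m H *m Q)) a.
Proof.
move=> QJ QA Hsym Ha.
have -> : a = 2^-1 * (a + a) by field.
apply: clarke_boundZ => //; apply: clarke_boundD => //.
  by move=> y t ysym; apply: symD => //; exact: symZ.
by rewrite -{1}QA; exact: spectral_clarke_bound_congr.
Qed.

Definition flip k : 'cV[R]_n := \col_i (if i == k then -1 else 1).

Lemma dbl_flip2 k i : dbl (flip k) 0 i * dbl (flip k) 0 i = 1.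
Proof. by rewrite dblE mxE; case: eqP => _; rewrite ?mulrNN mulr1. Qed.

Lemma flip_sqr k : Dmx (flip k) *m Dmx (flip k) = 1%:M.
Proof.
apply/matrixP => i j.
by rewrite mul_Dmx DmxE mulrnAr dbl_flip2 mxE.
Qed.

Lemma Dmx_comm x y : Dmx x *m Dmx y = Dmx y *m Dmx x.
Proof. by rewrite !Dmx_diag; exact: diag_mxC. Qed.

(** As [Q^2] is 1 or -1, conjugation by [Q] is an involution, and it exchanges the two summands. *)
Lemma average_commute G Q : Q^T *m Q = 1%:M -> Q^T = Q \/ Q^T = - Q ->
  (2^-1 *: (G + Q^T *m G *m Q)) *m Q = Q *m (2^-1 *: (G + Q^T *m G *m Q)).
Proof.
move=> QQ Qs; rewrite -scalemxAl -scalemxAr; congr (_ *: _).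
rewrite mulmxDl mulmxDr addrC !mulmxA; move: QQ.
case: Qs => ->; first by move=> QQ; rewrite QQ mul1mx -!mulmxA QQ mulmx1.
rewrite mulNmx => /(canRL (@opprK _)) QQ.
rewrite !mulmxN !mulNmx QQ mulNmx mul1mx -!mulmxA QQ.
by rewrite !mulmxN !mulmx1 opprK mulNmx opprK.
Qed.

(** The last clause keeps the commutations gained by earlier averagings, so that the step can be
    iterated. *)
Lemma spectral_clarke_bound_step d G a Q : Sym G -> symplectic Q ->
  Q^T *m Q = 1%:M -> Q^T = Q \/ Q^T = - Q ->
  (forall z, Q *m Dmx z = Dmx z *m Q) ->
  clarke_bound Sym phi (Dmx d) G a ->
  exists G', [/\ Sym G', clarke_bound Sym phi (Dmx d) G' a,
    forall z, frobenius_dot (Dmx z) G' = frobenius_dot (Dmx z) G,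
    G' *m Q = Q *m G' &
    forall B, Q *m B = B *m Q -> G *m B = B *m G -> G' *m B = B *m G'].
Proof.
move=> Gsym QJ QQ Qs QD Ga; exists (2^-1 *: (G + Q^T *m G *m Q)).
have QDQ z : Q^T *m Dmx z *m Q = Dmx z.
  by rewrite -mulmxA -QD mulmxA QQ mul1mx.
split.
- by apply: symZ; apply: symD => //; exact: sym_congr.
- exact: spectral_clarke_bound_average.
- move=> z; rewrite /frobenius_dot -scalemxAr linearZ /= mulmxDr linearD /=.
  have -> : \tr ((Dmx z)^T *m (Q^T *m G *m Q)) = \tr ((Dmx z)^T *m G).
    rewrite -/(frobenius_dot (Dmx z) _) -frobenius_dot_congr.
    have QQ' : Q *m Q^T = 1%:M by exact: mulmx1C.
    by rewrite QD -mulmxA QQ' mulmx1.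
  by field.
- exact: average_commute.
- move=> B QB GB; rewrite -scalemxAl -scalemxAr mulmxDl mulmxDr GB.
  have QB' : Q^T *m B = B *m Q^T.
    by case: Qs => ->; rewrite ?mulNmx ?mulmxN QB.
  by rewrite -!mulmxA QB (mulmxA G) GB !mulmxA QB'.
Qed.

(* Averaging over [J] and over the sign changes of the modes replaces [G] by
   the diagonal matrix of the means of its two diagonal entries in each
   mode. *)
Lemma spectral_clarke_bound_diag d G a : Sym G ->
  clarke_bound Sym phi (Dmx d) G a ->
  exists g, clarke_bound Sym phi (Dmx d) (Dmx g) a /\
    forall z, frobenius_dot (Dmx z) (Dmx g) = frobenius_dot (Dmx z) G.
Proof.
move=> Gsym Ga.
have [|||G1 [G1sym G1a G1z G1J _]] :=
  spectral_clarke_bound_step Gsym symplectic_Jmx _ _ _ Ga.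
- by rewrite tr_Jmx mulNmx mul_Jmx_Jmx opprK.
- by right; exact: tr_Jmx.
- exact: Jmx_Dmx.
have [G2 [G2sym G2a G2z G2J G2f]] : exists G2, [/\ Sym G2,
    clarke_bound Sym phi (Dmx d) G2 a,
    forall z, frobenius_dot (Dmx z) G2 = frobenius_dot (Dmx z) G,
    G2 *m J = J *m G2 &
    forall k, k \in enum 'I_n -> G2 *m Dmx (flip k) = Dmx (flip k) *m G2].
  elim: (enum 'I_n) => [|k r [G2 [G2sym G2a G2z G2J G2f]]].
    by exists G1; split.
  have [||||G3 [G3sym G3a G3z G3k G3B]] :=
    spectral_clarke_bound_step (Q := Dmx (flip k)) G2sym _ _ _ _ G2a.
  - by rewrite /symplectic tr_Dmx -Jmx_Dmx -mulmxA flip_sqr mulmx1.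
  - by rewrite tr_Dmx flip_sqr.
  - by left; exact: tr_Dmx.
  - by move=> z; exact: Dmx_comm.
  exists G3; split=> //.
  - by move=> z; rewrite G3z.
  - by apply: G3B => //; rewrite Jmx_Dmx.
  - move=> l; rewrite inE => /orP[/eqP->//|lr].
    by apply: G3B; [exact: Dmx_comm|exact: G2f].
(* Only distinct entries matter for [w]: commuting with all flips makes [G2] vanish between
   different modes, hence commute with [Dmx w]. *)
pose w : 'cV[R]_n := \col_i i%:R.
have [| |g G2g] := @eq_Dmx_of_commute _ _ w G2 _ G2sym G2J.
- by move=> i j; rewrite !mxE => /eqP; rewrite eqr_nat => /eqP/val_inj.
- apply/matrixP => i j; rewrite mul_Dmx mulmx_Dmx mulrC.
  have [ij|ij] := eqVneq (mode i) (mode j); first by rewrite !dblE ij.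
  rewrite (@Dmx_commute _ _ (flip (mode i)) G2 i j) ?mulr0//.
    by rewrite G2f// mem_enum.
  rewrite !dblE !mxE eqxx [mode j == _]eq_sym (negPf ij).
  by rewrite lt_eqF// (@lt_trans _ _ 0)// oppr_lt0.
by exists g; rewrite -G2g.
Qed.

(** The radius also keeps [y] and [y + t g] positive, where [phi (Dmx y) = f y]. *)
Lemma spectral_clarke_bound_restrict d g a : positive_vectors R n d ->
  clarke_bound Sym phi (Dmx d) (Dmx g) a -> clarke_bound setT f d g a.
Proof.
move=> d0 [e e0 phie]; have [m m0 md] := positive_vectors_near d0.
have g1 : 0 < 1 + `|g| by rewrite ltr_pwDl.
exists (Num.min e (m / 2 / (1 + `|g|))); first by rewrite lt_min e0 !divr_gt0.
move=> y t _; rewrite !lt_min => /andP[ye ym] /andP[t0 /andP[te tm]].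
have h : m / 2 / (1 + `|g|) <= m / 2.
  by rewrite ler_pdivrMr// ler_peMr ?lerDl// divr_ge0// ltW.
have y0 : positive_vectors R n y.
  by apply: md; apply: lt_le_trans ym _; lra.
have yt0 : positive_vectors R n (y + t *: g).
  apply: md; have : `|y + t *: g - d| <= `|y - d| + t * `|g|.
    by rewrite addrAC (le_trans (ler_normD _ _))// normrZ gtr0_norm.
  move: tm; rewrite ltr_pdivlMr//; lra.
rewrite -(spectral_function_Dmx f_sym y0) -(spectral_function_Dmx f_sym yt0).
rewrite DmxD DmxZ; apply: phie; rewrite ?t0//; first exact: sym_Dmx.
by rewrite -scaleN1r -DmxZ -DmxD scaleN1r norm_Dmx.
Qed.

End Bounds.

(** With [D_g] the diagonal mean of [M^T H M]: [<M D_y M^T / 2, H> = <D_y, D_g> / 2 = <y, g> <=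
    a]. *)
Lemma spectral_gradient_sup f A : symmetric_function f -> positive_definite A ->
  [set 2^-1 *: (M *m Dmx y *m M^T) |
    y in clarke_gradient setT f (spec A) & M in SPup A] `<=`
  clarke_gradient Sym (fun B => f (spec B)) A.
Proof.
move=> f_sym Apd _ [y /clarke_gradientP[_ yP] [M [MJ MA] <-]].
apply/clarke_gradientP; split.
  by apply: symZ; rewrite -{1}[M]trmxK; apply: sym_congr; exact: sym_Dmx.
move=> H a Hsym Ha.
have [d0 _ _] := symplectic_spectrumP Apd.
have := spectral_clarke_bound_congr MJ Ha; rewrite MA.
move=> /(spectral_clarke_bound_diag (sym_congr M Hsym))[g [ga gH]].
have := yP _ _ I (spectral_clarke_bound_restrict f_sym d0 ga).
congr (_ <= _); rewrite /frobenius_dot linearZ /= -scalemxAl linearZ /=.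
rewrite -/(frobenius_dot (M *m Dmx y *m M^T) H) frobenius_dot_congr -gH.
rewrite frobenius_dot_Dmx_Dmx.
by rewrite /frobenius_dot; field.
Qed.

End SpectralFunction.

(** * Bistochastic matrices *)

Section Bistochastic.
Context {R : realType} {n : nat}.
Implicit Types (S : 'M[R]_n) (d u w z g : 'cV[R]_n) (T : {set 'I_n}).

Definition block_bistochastic d S :=
  [/\ forall i j, 0 <= S i j, forall i, \sum_j S i j = 1,
      forall j, \sum_i S i j = 1 & forall i j, S i j != 0 -> d i 0 = d j 0].

(** The threshold [c] is constant on the levels of [d], with [u >= c] on [T] and [u <= c] off [T].
    As [S] mixes only equal values of [d], [u] may be replaced by [u - c]; the sum becomes [\sum_j
    ([j in T] - s_j) (u_j - c_j)], where no two factors have opposite signs. *)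
Lemma bistochastic_threshold d S u T : block_bistochastic d S ->
  (forall i j, i \in T -> j \notin T -> d i 0 = d j 0 -> u j 0 <= u i 0) ->
  0 <= \sum_(i in T) \sum_j S i j * (u i 0 - u j 0).
Proof.
move=> [S0 Sr Sc Sd] uT.
(* The default [- |u|] lies below every entry of [u]; it serves the levels contained in [T]. *)
pose c i := \big[Num.max/- `|u|]_(j | (j \notin T) && (d j 0 == d i 0)) u j 0.
have cT i : i \in T -> c i <= u i 0.
  move=> iT; apply/bigmax_leP; split.
    by have := le_coord_norm u i 0; rewrite ler_norml => /andP[].
  by move=> j /andP[jT /eqP dij]; apply: uT.
have cNT j : j \notin T -> u j 0 <= c j.
  by move=> jT; apply: (le_bigmax_cond _ (fun j => u j 0)); rewrite jT eqxx.
have Sc' i j : S i j * (u i 0 - u j 0) = S i j * ((u i 0 - c i) - (u j 0 - c j)).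
  have [->|/Sd dij] := eqVneq (S i j) 0; first by rewrite !mul0r.
  by have -> : c i = c j by [rewrite /c dij]; congr (_ * _); ring.
pose s j := \sum_(i in T) S i j.
have s0 j : 0 <= s j by apply: sumr_ge0.
have s1 j : s j <= 1.
  rewrite -(Sc j) [leRHS](bigID (mem T))/= lerDl; exact: sumr_ge0.
have -> : \sum_(i in T) \sum_j S i j * (u i 0 - u j 0) =
    \sum_j ((j \in T)%:R - s j) * (u j 0 - c j).
  under eq_bigr do under eq_bigr do rewrite Sc' mulrBr.
  under eq_bigr do rewrite sumrB -mulr_suml Sr mul1r.
  rewrite sumrB exchange_big /= [X in X - _]big_mkcond -sumrB.
  apply: eq_bigr => j _; rewrite -mulr_suml -/(s j) mulrBl.
  by case: (j \in T); rewrite ?mul1r ?mul0r.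
apply: sumr_ge0 => j _; have [jT|jT] := boolP (j \in T).
  by rewrite mulr_ge0 ?subr_ge0// cT.
by rewrite mulr0n sub0r mulNr -mulrN mulr_ge0// opprB subr_ge0 cNT.
Qed.

(** Layer by layer: equal row and column sums allow adding a constant to [w], so [w >= 0]; then its
    least positive value times the indicator of its support is peeled off, and each layer is a
    threshold inequality. *)
Lemma bistochastic_rearrangement d S u w : block_bistochastic d S ->
  (forall i j, d i 0 = d j 0 -> w i 0 < w j 0 -> u i 0 <= u j 0) ->
  0 <= \sum_i \sum_j S i j * (w i 0 * (u i 0 - u j 0)).
Proof.
move=> dS; have [S0 Sr Sc Sd] := dS.
wlog w0 : w / forall i, 0 <= w i 0 => [hw|].
  move=> wu; have := hw (\col_i (w i 0 + `|w|)).
  have -> : \sum_i \sum_j S i j * ((\col_i (w i 0 + `|w|)) i 0 * (u i 0 - u j 0)) =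
      \sum_i \sum_j S i j * (w i 0 * (u i 0 - u j 0)) +
      `|w| * (\sum_i \sum_j S i j * (u i 0 - u j 0)).
    rewrite mulr_sumr -big_split; apply: eq_bigr => i _ /=.
    rewrite mulr_sumr -big_split; apply: eq_bigr => j _ /=.
    by rewrite mxE; ring.
  have -> : \sum_i \sum_j S i j * (u i 0 - u j 0) = 0.
    under eq_bigr do under eq_bigr do rewrite mulrBr.
    under eq_bigr do rewrite sumrB -mulr_suml Sr mul1r.
    rewrite sumrB exchange_big /=; apply/eqP; rewrite subr_eq0; apply/eqP.
    by apply: eq_bigr => j _; rewrite -mulr_suml Sc mul1r.
  rewrite mulr0 addr0; apply.
    move=> i; rewrite mxE; have := le_coord_norm w i 0.
    by rewrite ler_norml => /andP[]; lra.
  by move=> i j dij; rewrite !mxE ltrD2r; exact: wu.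
have [k] := ubnP #|finset (fun i => 0 < w i 0)|; elim: k w w0 => // k IH w w0.
set T := finset (fun i => 0 < w i 0).
have inT i : (i \in T) = (0 < w i 0) by rewrite inE.
rewrite ltnS => Tk wu.
have [T0|[i0 i0T]] := set_0Vmem T.
  apply: sumr_ge0 => i _; apply: sumr_ge0 => j _.
  have : i \in T = false by rewrite T0 finset.in_set0.
  rewrite inT lt_neqAle w0 andbT => /negbFE/eqP <-.
  by rewrite mul0r mulr0.
have [i1 i1T wmin] := arg_minP (fun i => w i 0) i0T; set e := w i1 0 in wmin.
have {}i1T : i1 \in T := i1T; have e0 : 0 < e by rewrite -inT.
pose w' : 'cV[R]_n := \col_i (w i 0 - e *+ (i \in T)).
have wT i : i \notin T -> w i 0 = 0.
  by rewrite inT -leNgt => wi; apply/eqP; rewrite eq_le wi w0.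
have w'0 i : 0 <= w' i 0.
  rewrite mxE; have [iT|iT] := boolP (i \in T).
    by rewrite subr_ge0 wmin.
  by rewrite subr0.
have -> : \sum_i \sum_j S i j * (w i 0 * (u i 0 - u j 0)) =
    \sum_i \sum_j S i j * (w' i 0 * (u i 0 - u j 0)) +
    e * (\sum_(i in T) \sum_j S i j * (u i 0 - u j 0)).
  rewrite mulr_sumr [X in _ = _ + X]big_mkcond -big_split; apply: eq_bigr => i _ /=.
  rewrite mxE; case: (i \in T); last by rewrite subr0 addr0.
  rewrite mulr_sumr -big_split; apply: eq_bigr => j _ /=.
  by rewrite mulr1n; ring.
apply: addr_ge0.
  apply: IH => // [|i j dij].
    apply: leq_trans Tk; apply: proper_card; apply/properP; split.
      apply/fintype.subsetP => i; rewrite inT inE mxE -inT.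
      have [//|iT] := boolP (i \in T).
      by rewrite wT// subr0 ltxx.
    by exists i1 => //; rewrite inE mxE i1T mulr1n subrr ltxx.
  rewrite !mxE; have [iT|iT] := boolP (i \in T); have [jT|jT] := boolP (j \in T).
  - by rewrite ltrD2r; exact: wu.
  - rewrite (wT j)// subr0 => /(le_lt_trans _)-/(_ 0).
    by rewrite subr_ge0 wmin// ltxx => /(_ isT).
  - move=> _; apply: wu => //; rewrite (wT i)//.
    by rewrite -inT.
  - by rewrite !subr0; exact: wu.
rewrite mulr_ge0 ?(ltW e0)//; apply: bistochastic_threshold (dS) _ => i j iT jT dij.
apply: wu => //; rewrite (wT j)//.
by rewrite -inT.
Qed.

(** Take [s] optimal among the permutations preserving [d]. No transposition inside a level improves
    it, so [w] and [u o s] are similarly ordered on each level, and rearrangement applies to [S]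
    with its columns permuted. This does the work of Birkhoff's theorem. *)
Lemma bistochastic_perm_max d S u w : block_bistochastic d S ->
  exists s : 'S_n, (forall i, d (s i) 0 = d i 0) /\
    \sum_i w i 0 * (S *m u) i 0 <= \sum_i w i 0 * u (s i) 0.
Proof.
move=> [S0 Sr Sc Sd].
pose P (s : 'S_n) := [forall i, d (s i) 0 == d i 0].
pose F (s : 'S_n) := \sum_i w i 0 * u (s i) 0.
have P1 : P 1%g by apply/forallP => i; rewrite perm1.
have [s /forallP Ps sF] := arg_maxP F P1.
have smax s' : P s' -> F s' <= F s by exact: sF.
have ds i : d (s i) 0 = d i 0 by apply/eqP.
exists s; split=> //.
pose S' : 'M[R]_n := \matrix_(i, k) S i (s k).
pose u' : 'cV[R]_n := \col_i u (s i) 0.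
have dS' : block_bistochastic d S'.
  split=> [i j|i|j|i j]; first by rewrite mxE.
  - under eq_bigr do rewrite mxE; rewrite -(Sr i).
    by rewrite [RHS](reindex_inj (@perm_inj _ s)).
  - by under eq_bigr do rewrite mxE; exact: Sc.
  - by rewrite mxE => /Sd ->.
have := bistochastic_rearrangement (u := u') (w := w) dS'.
have -> : \sum_i \sum_j S' i j * (w i 0 * (u' i 0 - u' j 0)) =
    \sum_i w i 0 * u (s i) 0 - \sum_i w i 0 * (S *m u) i 0.
  rewrite -sumrB; apply: eq_bigr => i _.
  have [_ Sr' _ _] := dS'.
  under eq_bigr do rewrite mulrBr mulrBr.
  rewrite sumrB -mulr_suml Sr' mul1r mxE; congr (_ - _).
  rewrite mxE mulr_sumr [RHS](reindex_inj (@perm_inj _ s)).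
  by apply: eq_bigr => j _; rewrite !mxE mulrCA.
rewrite subr_ge0; apply=> i j dij wij; rewrite !mxE leNgt; apply/negP => uij.
have ij : i != j by apply: contraTneq wij => ->; rewrite ltxx.
have := smax (tperm i j * s)%g; rewrite leNgt => /(_ _)/negP[].
  apply/forallP => k; rewrite permM ds; apply/eqP.
  by case: tpermP => [->|->|].
rewrite /F (bigD1 i)//= (bigD1 j) 1?eq_sym//= [ltRHS](bigD1 i)//=.
rewrite [X in _ < _ + X](bigD1 j) 1?eq_sym//= !permM tpermL tpermR !addrA.
rewrite [X in _ < _ + X](eq_bigr (fun k => w k 0 * u (s k) 0)).
  by rewrite ltrD2r; nra.
by move=> k /andP[ki kj]; rewrite permM tpermD// eq_sym.
Qed.

(* The point of [G] nearest to [S u] is [S u]: otherwise the direction to [S u]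
   separates it from all permutations of [u]. *)
Lemma bistochastic_mem d S u (G : set 'cV[R]_n) c : block_bistochastic d S ->
  closed G -> (forall g, G g -> `|g| <= c) ->
  (forall g h t, G g -> G h -> 0 < t < 1 -> G (g + t *: (h - g))) ->
  (forall s : 'S_n, (forall i, d (s i) 0 = d i 0) -> G (perm_mx s *m u)) ->
  G (S *m u).
Proof.
move=> dS Gcl Gc Gconv Gs; set z := S *m u.
have Gu : G (perm_mx 1%g *m u) by apply: Gs => i; rewrite perm1.
pose F (g : 'cV[R]_n) := frobenius_dot (z - g) (z - g).
have cF : continuous F.
  move=> g; have cB : (fun h => z - h) @ nbhs g --> z - g.
    by apply: cvgB; [exact: cvg_cst|exact: cvg_id].
  apply: (@cvg_mxtrace _ _ (nbhs g)); apply: (@cvg_mulmx _ _ (nbhs g)) => //.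
  exact: (@cvg_trmx _ _ (nbhs g)).
have [g Gg gmin] := closed_min_mx Gcl cF Gu (fun M GM _ => Gc M GM).
have dotE (a b : 'cV[R]_n) : frobenius_dot a b = \sum_i a i 0 * b i 0.
  by rewrite frobenius_dotE big_ord1.
have [s [ds smax]] := bistochastic_perm_max u (z - g) dS.
rewrite -/z in smax.
have Gsu := Gs s ds; set h := perm_mx s *m u in Gsu.
have hE i : h i 0 = u (s i) 0 by rewrite /h -row_permE mxE.
set D := \sum_i (z - g) i 0 * (h i 0 - g i 0).
have D0 : D <= 0.
  rewrite leNgt; apply/negP => Dpos.
  pose N := \sum_i (h i 0 - g i 0) ^+ 2.
  have N0 : 0 <= N by apply: sumr_ge0 => i _; exact: sqr_ge0.
  (* On the segment from [g] to [h] the squared distance to [z] changes by [t^2 N - 2 t D]. *)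
  have step t : 0 < t < 1 -> 2 * D <= t * N.
    move=> t01; have := gmin _ (Gconv _ _ _ Gg Gsu t01).
    rewrite /F !dotE -subr_ge0 -sumrB.
    rewrite (eq_bigr (fun i => t ^+ 2 * (h i 0 - g i 0) ^+ 2 -
        t * 2 * ((z - g) i 0 * (h i 0 - g i 0)))); last first.
      by move=> i _; rewrite !mxE; ring.
    rewrite sumrB -!mulr_sumr -/D -/N expr2 -!mulrA -mulrBr pmulr_rge0 ?subr_ge0//.
    by case/andP: t01.
  pose t := Num.min 2^-1 (D / (N + 1)).
  have N1 : 0 < N + 1 by rewrite ltr_wpDl.
  have t0 : 0 < t by rewrite lt_min invr_gt0 ltr0n divr_gt0.
  have tN : t * (N + 1) <= D by rewrite -ler_pdivlMr// ge_min lexx orbT.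
  have t1 : t < 1.
    by rewrite (@le_lt_trans _ _ 2^-1)// ?ge_min ?lexx// invf_lt1// ltr1n.
  have := step t; rewrite t0 t1 => /(_ isT); lra.
(* [|z - g|^2 <= D], because [h] is at least as far as [z] in the direction [z - g]. *)
suff : z - g = 0 by move/subr0_eq => ->.
apply: frobenius_dot_eq0; apply: le_trans D0; rewrite dotE /D.
rewrite -subr_ge0 -sumrB.
move: smax; rewrite -subr_ge0 -sumrB; congr (_ <= _); apply: eq_bigr => i _.
by rewrite hE !mxE; ring.
Qed.

End Bistochastic.

(** * One-sided slopes of spectral functions *)

Section OrthogonalProjection.
Context {R : realType}.

Lemma mxrank_gram p q (A : 'M[R]_(p, q)) : \rank (A *m A^T) = \rank A.
Proof.
apply/eqP; rewrite eqn_leq mxrankM_maxl /= -[X in (X <= _)%N](mxrank_mul_ker A A^T).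
rewrite -[leqRHS]addn0 leq_add2l leqn0 mxrank_eq0; apply/eqP.
set U := (A :&: kermx A^T)%MS.
have /submxP[c Uc] : (U <= A)%MS by exact: capmxSl.
have /sub_kermxP UA : (U <= kermx A^T)%MS by exact: capmxSr.
have UU : U *m U^T = 0 by rewrite {2}Uc trmx_mul mulmxA UA mul0mx.
apply: frobenius_dot_eq0; rewrite /frobenius_dot mxtrace_mulC UU.
by rewrite mxtrace0.
Qed.

(** The Gram matrix [V V^T] of the normal equations may be singular; they are solvable because it
    has the row space of [V^T]. *)
Lemma orthogonal_projection p q m (L : 'I_m -> 'M[R]_(p, q)) (G : 'M[R]_(p, q)) :
  exists c : 'I_m -> R, forall k,
    frobenius_dot (G - \sum_l c l *: L l) (L k) = 0.
Proof.
pose V : 'M[R]_(m, p * q) := \matrix_k mxvec (L k).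
have dotE (A B : 'M[R]_(p, q)) : frobenius_dot A B = (mxvec A *m (mxvec B)^T) 0 0.
  rewrite frobenius_dotE exchange_big /= pair_bigA /= mxE.
  rewrite (reindex _ (curry_mxvec_bij p q)) /=.
  by apply: eq_bigr => -[i j] _; rewrite /= mxE !mxvecE.
have /submxP[c cE] : (mxvec G *m V^T <= V *m V^T)%MS.
  apply: (@submx_trans _ _ _ _ _ _ V^T); first exact: submxMl.
  rewrite -(geq_leqif (mxrank_leqif_sup (submxMl V V^T))).
  by rewrite mxrank_tr mxrank_gram.
exists (fun l => c 0 l) => k; rewrite dotE linearB linear_sum /=.
have -> : \sum_l mxvec (c 0 l *: L l) = c *m V.
  by rewrite mulmx_sum_row; apply: eq_bigr => l _; rewrite rowK linearZ.
have -> : (mxvec (L k))^T = col k V^T by rewrite -tr_row rowK.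
by rewrite colE mulmxA mulmxBl -mulmxA -cE subrr mul0mx mxE.
Qed.
End OrthogonalProjection.

(** * Slopes along orbit directions and along general directions *)

Section SpectralDerivative.
Context {R : realType} {n : nat}.
Implicit Types (M A B C G H Q Z : 'M[R]_(n + n)) (x y z w d g : 'cV[R]_n).
Local Notation J := (Jmx R n).
Local Notation spec := (@symplectic_spectrum R n).
Local Notation Sym := (symmetric_matrices R (n + n)).

Definition lipschitz_near (f : 'cV[R]_n -> R) d := exists r K : R,
  [/\ 0 < r, 0 < K & forall y z, `|y - d| < r -> `|z - d| < r ->
    `|f y - f z| <= K * `|y - z|].

Lemma lipschitz_nearP f d : locally_lipschitz_near setT f d -> lipschitz_near f d.
Proof.
move=> [K [U Ud fU]]; move: Ud; rewrite /within /= => /nbhs_ballP[r /= r0 rU].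
exists r, (`|K| * (n * 1)%:R + 1); split=> // y z yd zd.
have U' y' : `|y' - d| < r -> U y'.
  by move=> yr; apply: rU => //; rewrite -ball_normE /= distrC.
apply: le_trans (fU y z I I (U' _ yd) (U' _ zd)) _.
apply: (@le_trans _ _ (`|K| * frobenius_norm (y - z))).
  by rewrite ler_wpM2r ?ler_norm// sqrtr_ge0.
rewrite mulrDl mul1r -mulrA ler_wpDr// ler_wpM2l//.
exact: frobenius_norm_le.
Qed.

Lemma lipschitz_near_open f d : lipschitz_near f d ->
  exists2 r : R, 0 < r & forall y, `|y - d| < r -> lipschitz_near f y.
Proof.
move=> [r [K [r0 K0 fK]]]; exists (r / 2) => [|y yd]; first by rewrite divr_gt0.
have r2 : 0 < r / 2 by rewrite divr_gt0.
exists (r / 2), K; split=> // z w zy wy.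
by apply: fK; [have := ler_distD y z d|have := ler_distD y w d]; lra.
Qed.

Section SymmetricFunction.
Variable f : 'cV[R]_n -> R.
Hypothesis f_sym : symmetric_function f.
Local Notation phi := (fun B => f (spec B)).

Lemma spectral_lipschitz A : positive_definite A -> lipschitz_near f (spec A) ->
  exists r K : R, [/\ 0 < r, 0 < K & forall B C, Sym B -> Sym C ->
    `|B - A| < r -> `|C - A| < r ->
    [/\ positive_definite B, `|spec B - spec C| <= K * `|B - C|,
      `|phi B - phi C| <= K * `|B - C| & forall M, SPup B M -> `|M| <= K]].
Proof.
move=> Apd [r [K [r0 K0 fK]]].
have [s [c [s0 c0 specc]]] := symplectic_spectrum_lipschitz Apd.
have Asym : Sym A by case: Apd.
exists (Num.min s (r / c)), (c + K * c); split.
- by rewrite lt_min s0 divr_gt0.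
- by rewrite addr_gt0// mulr_gt0.
move=> B C Bsym Csym; rewrite !lt_min => /andP[Bs Br] /andP[Cs Cr].
have [Bpd BC BM] := specc B C Bsym Csym Bs Cs.
have AA : `|A - A| < s by rewrite subrr normr0.
have nearA B' : Sym B' -> `|B' - A| < s -> `|B' - A| < r / c ->
    `|spec B' - spec A| < r.
  move=> B's B'1 B'2; have [_ BA _] := specc B' A B's Asym B'1 AA.
  by apply: le_lt_trans BA _; rewrite mulrC -ltr_pdivlMr.
have Kc : c <= c + K * c by rewrite lerDl mulr_ge0// ltW.
split=> //.
- by apply: le_trans BC _; rewrite ler_wpM2r.
- apply: le_trans (fK _ _ (nearA B Bsym Bs Br) (nearA C Csym Cs Cr)) _.
  apply: (@le_trans _ _ (K * (c * `|B - C|))); first by rewrite ler_pM2l.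
  by rewrite mulrA ler_wpM2r// lerDr ltW.
- by move=> M /BM Mc; exact: le_trans Mc Kc.
Qed.

(** Agreement up to [s^2] transfers one-sided slopes without presupposing that derivatives exist. *)
Definition same_slope A G G' := exists C r : R, [/\ 0 <= C, 0 < r &
  forall s, 0 < s < r -> `|phi (A + s *: G) - phi (A + s *: G')| <= C * s ^+ 2].

Lemma same_slope_trans A G G' G'' :
  same_slope A G G' -> same_slope A G' G'' -> same_slope A G G''.
Proof.
move=> [C [r [C0 r0 GG']]] [C' [r' [C'0 r'0 G'G'']]].
exists (C + C'), (Num.min r r'); split.
- exact: addr_ge0.
- by rewrite lt_min r0.
move=> s; rewrite lt_min => /andP[s0 /andP[sr sr']].
have := GG' s; have := G'G'' s; rewrite s0 sr sr' mulrDl => /(_ isT) h' /(_ isT) h.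
exact: le_trans (ler_distD _ _ _) (lerD h h').
Qed.

Lemma tangent_congr x B (v : 'cV[R]_(n + n)) c :
  let X := v *m v^T *m J in
  (1%:M + c *: X)^T *m (Dmx x + B) *m (1%:M + c *: X) =
  Dmx x + B + c *: tangent x (v *m v^T) +
    (c *: (X^T *m B + B *m X) + c ^+ 2 *: (X^T *m (Dmx x + B) *m X)).
Proof.
move=> X; have -> : tangent x (v *m v^T) = X^T *m Dmx x + Dmx x *m X.
  by rewrite /tangent -mulmxA -/X trmx_mul tr_Dmx addrC.
rewrite [(1%:M + _)^T]linearD /= [(_ *: X)^T]linearZ /= trmx1.
rewrite !(mulmxDl, mulmxDr) -!(scalemxAl, scalemxAr) !(mul1mx, mulmx1).
move: (X^T *m Dmx x *m X) (X^T *m B *m X) (X^T *m B) (B *m X).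
move: (X^T *m Dmx x) (Dmx x *m X) (Dmx x).
by move=> a1 a2 a3 a4 a5 a6 a7; apply/matrixP => i j; rewrite !mxE; ring.
Qed.

(* The symplectic transvections move [D + s (G + c L)] onto [D + s G] up to
   [O(s^2)], for a tangent direction [L]. *)
Lemma same_slope_tangent x G (v : 'cV[R]_(n + n)) c :
  lipschitz_near f (spec (Dmx x)) -> positive_definite (Dmx x) -> Sym G ->
  same_slope (Dmx x) G (G + c *: tangent x (v *m v^T)).
Proof.
move=> flip Dpd Gsym; have [r [K [r0 K0 phiK]]] := spectral_lipschitz Dpd flip.
pose X := v *m v^T *m J; set L := tangent x (v *m v^T).
pose E0 := c *: (X^T *m G + G *m X) + c ^+ 2 *: (X^T *m Dmx x *m X).
pose E1 := c ^+ 2 *: (X^T *m G *m X).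
pose b := `|E0| + `|E1|; have b0 : 0 <= b by rewrite addr_ge0.
pose k := 1 + `|G + c *: L| + b; have k0 : 0 < k by rewrite ltr_pwDl// ltr_pwDl.
exists (K * b), (Num.min 1 (r / k)); split.
- by rewrite mulr_ge0// ltW.
- by rewrite lt_min ltr01 divr_gt0.
move=> s; rewrite lt_min => /andP[s0 /andP[s1]]; rewrite ltr_pdivlMr// => sk.
have Lsym : Sym (G + c *: L) by apply: symD => //; apply: symZ; exact: tr_tangent.
have sG B : Sym B -> Sym (Dmx x + s *: B).
  by move=> Bsym; apply: symD; [exact: sym_Dmx|exact: symZ].
have XX : (1%:M + (s * c) *: X)^T *m (Dmx x + s *: G) *m (1%:M + (s * c) *: X) =
    Dmx x + s *: (G + c *: L) + s ^+ 2 *: (E0 + s *: E1).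
  rewrite tangent_congr -/X -/L /E0 /E1 (mulmxDr X^T) (mulmxDl _ _ X).
  rewrite -!(scalemxAl, scalemxAr).
  move: (X^T *m Dmx x *m X) (X^T *m G *m X) (X^T *m G) (G *m X) (Dmx x).
  by generalize L => a6 a1 a2 a3 a4 a5; apply/matrixP => i j; rewrite !mxE; ring.
have E : `|s ^+ 2 *: (E0 + s *: E1)| <= s ^+ 2 * b.
  rewrite normrZ ger0_norm ?sqr_ge0// ler_wpM2l ?sqr_ge0//.
  rewrite (le_trans (ler_normD _ _))// lerD2l normrZ gtr0_norm// ler_piMl//.
  exact: ltW.
have GL := ger0_norm (ltW s0).
have nL : `|Dmx x + s *: (G + c *: L) - Dmx x| <= s * `|G + c *: L|.
  by rewrite addrAC subrr add0r normrZ GL.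
have ss : s ^+ 2 * b <= s * b by rewrite ler_wpM2r// expr2 ler_piMl// ltW.
rewrite -(symplectic_spectrum_congr _ (symplectic_transvection (s * c) v)) -/X XX.
set D1 := Dmx x + s *: (G + c *: L) in nL *.
have [] := phiK (D1 + s ^+ 2 *: (E0 + s *: E1)) D1.
- rewrite -XX; apply: sym_congr; exact: sG.
- exact: sG.
- rewrite addrAC (le_lt_trans (ler_normD _ _))//.
  move: sk; rewrite /k 2!mulrDr mulr1 => sk; lra.
- move: sk; rewrite /k 2!mulrDr mulr1 => sk.
  have sb : 0 <= s * b by rewrite mulr_ge0// ltW.
  by apply: le_lt_trans nL _; lra.
move=> _ _ h _; apply: le_trans h _; rewrite addrAC subrr add0r -mulrA [b * _]mulrC.
by rewrite ler_pM2l.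
Qed.

Lemma same_slope_tangents x G m (v : 'I_m -> 'cV[R]_(n + n)) (c : 'I_m -> R) :
  lipschitz_near f (spec (Dmx x)) -> positive_definite (Dmx x) -> Sym G ->
  same_slope (Dmx x) G (G + \sum_k c k *: tangent x (v k *m (v k)^T)).
Proof.
move=> flip Dpd Gsym.
suff : Sym (G + \sum_k c k *: tangent x (v k *m (v k)^T)) /\
  same_slope (Dmx x) G (G + \sum_k c k *: tangent x (v k *m (v k)^T)) by case.
elim: (index_enum _) => [|k r [IHsym IH]].
  rewrite big_nil addr0; split=> //; exists 0, 1; split=> // s _.
  by rewrite subrr normr0 mul0r.
rewrite big_cons addrCA addrC; split.
  by apply: symD => //; apply: symZ; exact: tr_tangent.
exact/(same_slope_trans IH)/same_slope_tangent.
Qed.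

(** Congruence by the transvection of parameter [t c] leaves [phi] unchanged and sends [B] to
    [B + t c L + t E], with [E] small near [Dmx x]; the Lipschitz constant then bounds the increment
    by [t b]. As [c] and [b > 0] are arbitrary, the Clarke derivative is at most 0 along both [L]
    and [- L]. *)
Lemma clarke_bound_tangent x (v : 'cV[R]_(n + n)) c b :
  lipschitz_near f (spec (Dmx x)) -> positive_definite (Dmx x) -> 0 < b ->
  clarke_bound Sym phi (Dmx x) (c *: tangent x (v *m v^T)) b.
Proof.
move=> flip Dpd b0; have [r [K [r0 K0 phiK]]] := spectral_lipschitz Dpd flip.
pose X := v *m v^T *m J; set L := tangent x (v *m v^T).
pose N : R := (n + n)%:R.
pose k := `|c| * (N * (`|X| * 1) + N * (1 * `|X|)) +
  c ^+ 2 * (N * (N * (`|X| * (`|Dmx x| + 1)) * `|X|)).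
have N0 : 0 <= N by [].
have k0 : 0 <= k.
  apply: addr_ge0; first by rewrite mulr_ge0// addr_ge0// mulr_ge0// mulr_ge0.
  by do ![exact: sqr_ge0 | done | apply: mulr_ge0 | apply: addr_ge0].
have cL0 : 0 <= `|c *: L| by [].
pose m := 1 + `|c *: L| + k; have m0 : 0 < m by rewrite !ltr_wpDr.
(* The second term keeps both points in the Lipschitz ball; the third gives [K |E| <= b], since
   [|E| <= e k]. *)
pose e := Num.min 1 (Num.min (r / (1 + m)) (b / (K * (k + 1)))).
have k1 : 0 < K * (k + 1) by rewrite mulr_gt0// ltr_wpDl.
have m1 : 0 < 1 + m by rewrite addr_gt0.
have e0 : 0 < e by rewrite !lt_min ltr01 !divr_gt0.
have e1 : e <= 1 by rewrite ge_min lexx.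
have er : e * (1 + m) <= r by rewrite -ler_pdivlMr// !ge_min lexx orbT.
have eb : e * (K * (k + 1)) <= b by rewrite -ler_pdivlMr// !ge_min lexx !orbT.
exists e => // B t Bsym BD /andP[t0 te].
set Y := B - Dmx x in BD; have BE : B = Dmx x + Y by rewrite /Y addrC subrK.
have t1 : t <= 1 by exact: le_trans (ltW te) e1.
have Y1 : `|Y| <= 1 by exact: le_trans (ltW BD) e1.
set S := 1%:M + (t * c) *: X.
have SS : symplectic S by exact: symplectic_transvection.
pose E := c *: (X^T *m Y + Y *m X) + (t * c ^+ 2) *: (X^T *m (Dmx x + Y) *m X).
have SBS : S^T *m B *m S = B + t *: (c *: L) + t *: E.
  rewrite {1}BE tangent_congr -/X -/L -BE /E scalerA; congr (_ + _).
  rewrite [RHS]scalerDr !scalerA; have -> : (t * c) ^+ 2 = t * (t * c ^+ 2) by ring.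
  by rewrite -BE.
have Ek : `|E| <= e * k.
  have Ye := ltW BD.
  rewrite (le_trans (ler_normD _ _))// mulrDr lerD// !normrZ.
    rewrite mulrCA ler_wpM2l// (le_trans (ler_normD _ _))// mulrDr lerD//.
      rewrite (le_trans (norm_mulmx_bound (lexx _) Ye))// norm_trmx mulr1.
      by rewrite le_eqVlt; apply/orP; left; apply/eqP; ring.
    rewrite (le_trans (norm_mulmx_bound Ye (lexx _)))// mul1r.
    by rewrite le_eqVlt; apply/orP; left; apply/eqP; ring.
  rewrite gtr0_norm// -expr2 -normrX ger0_norm ?sqr_ge0// -mulrA.
  apply: ler_pM; [exact: ltW|by rewrite mulr_ge0 ?sqr_ge0|exact: ltW|].
  rewrite ler_wpM2l ?sqr_ge0//.
  apply: norm_mulmx_bound => //; apply: norm_mulmx_bound; first by rewrite norm_trmx.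
  by rewrite (le_trans (ler_normD _ _))// lerD2l.
have Lsym : Sym (c *: L) by apply: symZ; exact: tr_tangent.
have tcL : t * `|c *: L| <= e * `|c *: L| by rewrite ler_wpM2r// ltW.
have tE : t * `|E| <= e * k.
  by rewrite (le_trans _ Ek)// ler_piMl.
have ek : 0 <= e * k by rewrite mulr_ge0// ltW.
rewrite -[phi B](congr1 f (symplectic_spectrum_congr B SS)).
have [] := phiK (B + t *: (c *: L)) (S^T *m B *m S).
- by apply: symD => //; exact: symZ.
- exact: sym_congr.
- rewrite addrAC (le_lt_trans (ler_normD _ _))// normrZ gtr0_norm// -/Y.
  by move: er; rewrite /m; lra.
- rewrite SBS -(addrA B) addrAC (le_lt_trans (ler_normD _ _))//.
  have := ler_normD (t *: (c *: L)) (t *: E).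
  rewrite ![`|t *: _|]normrZ !(gtr0_norm t0) -/Y.
  by move: er; rewrite /m; lra.
move=> _ _ /ler_normlP[_ h] _; apply: le_trans h _.
rewrite SBS opprD addrA subrr sub0r normrN normrZ gtr0_norm// mulrCA ler_pM2l//.
apply: le_trans eb; rewrite mulrCA ler_pM2l//; apply: le_trans Ek _.
by rewrite ler_wpM2l ?ltW// ltrDl.
Qed.

Lemma positive_definite_Dmx x : positive_vectors R n x -> positive_definite (Dmx x).
Proof.
move=> x0; split=> [|v v0]; first exact: sym_Dmx.
rewrite -/(qf (Dmx x) v) qf_Dmx.
have [i vi] : exists i, v i 0 != 0.
  apply/existsP; apply: contraNT v0; rewrite negb_exists => /forallP v0.
  by apply/eqP/colP => i; have := v0 i; rewrite negbK !mxE => /eqP.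
rewrite (bigD1 i)//= ltr_pwDl//; first by rewrite mulr_gt0 ?dbl_gt0// exprn_even_gt0.
by apply: sumr_ge0 => k _; rewrite mulr_ge0 ?sqr_ge0// ltW// dbl_gt0.
Qed.

Lemma Dmx_spectrum A : positive_definite A -> spec (Dmx (spec A)) = spec A.
Proof.
move=> /symplectic_spectrumP[x0 xs _]; apply: symplectic_spectrum_eq; split=> //.
by exists 1%:M; [exact: symplectic1|rewrite trmx1 mul1mx mulmx1].
Qed.

(** [Dmx (half_diag G)] is the orthogonal projection of [G] onto the matrices [Dmx y]. *)
Definition half_diag G : 'cV[R]_n :=
  \col_i (2^-1 * (G (lshift n i) (lshift n i) + G (rshift n i) (rshift n i))).

Lemma frobenius_dot_half_diag z G :
  frobenius_dot (Dmx z) G = 2 * frobenius_dot z (half_diag G).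
Proof.
rewrite frobenius_dot_Dmx frobenius_dotE big_ord1 mulr_sumr.
by apply: eq_bigr => i _; rewrite [half_diag G _ _]mxE; field.
Qed.

Lemma half_diag_eq G y :
  (forall z, frobenius_dot (Dmx z) G = frobenius_dot (Dmx z) (Dmx y)) ->
  half_diag G = y.
Proof.
move=> Gy; apply/eqP; rewrite -subr_eq0; apply/eqP; apply: frobenius_dot_eq0.
set z := half_diag G - y; have := Gy z.
rewrite frobenius_dot_half_diag frobenius_dot_Dmx_Dmx => /(mulfI _) zG.
rewrite /frobenius_dot /z mulmxBr linearB /=.
rewrite -/(frobenius_dot _ _) -/(frobenius_dot _ y).
by rewrite zG ?subrr// pnatr_eq0.
Qed.

(* In coordinates where [A] is [Dmx d], the compression [G] of [H] is the sum
   of tangent directions, which do not contribute, and of a matrix commuting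
   with [J] and [Dmx d], which is diagonalized within the stabilizer. *)
Lemma spectral_slope A H : positive_definite A -> Sym H ->
  lipschitz_near f (spec A) ->
  exists M (C r : R), [/\ SPup A M, 0 <= C, 0 < r &
    forall s, 0 < s < r ->
      `|phi (A + s *: H) - f (spec A + s *: half_diag (M^T *m H *m M))|
        <= C * s ^+ 2].
Proof.
move=> Apd Hsym flip; have := symplectic_spectrumP Apd.
have specD := Dmx_spectrum Apd.
set d := spec A in flip specD *; move=> [d0 _ [N NJ NA]].
pose G := N^T *m H *m N; have Gsym : Sym G by exact: sym_congr.
pose I2 := ('I_(n + n) * 'I_(n + n))%type.
pose v (k : 'I_#|{: I2}|) : 'cV[R]_(n + n) := polar_vector (enum_val k).
pose L k := tangent d (v k *m (v k)^T).
have [c cL] := orthogonal_projection L G.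
pose Z := G - \sum_k c k *: L k.
have Lsym k : Sym (L k) by exact: tr_tangent.
have sumsym (r : seq 'I_#|{: I2}|) : Sym (\sum_(k <- r) c k *: L k).
  elim: r => [|k r IH]; first by rewrite big_nil /symmetric_matrices /= trmx0.
  by rewrite big_cons; apply: symD => //; exact: symZ.
have Zsym : Z^T = Z by rewrite /Z linearB /= (sumsym _) Gsym.
have [ZJ ZD] : Z *m J = J *m Z /\ Z *m Dmx d = Dmx d *m Z.
  apply: tangent_orth_commute => // ij.
  by have := cL (enum_rank ij); rewrite /L /v enum_rankK.
have [Q [y [QQ QJ QD QZ]]] := codiagonalization Zsym ZJ ZD.
have QS : symplectic Q by rewrite /symplectic -mulmxA -QJ mulmxA QQ mul1mx.
have QDQ : Q^T *m Dmx d *m Q = Dmx d by rewrite -mulmxA -QD mulmxA QQ mul1mx.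
have Dpd := positive_definite_Dmx d0.
have lipD : lipschitz_near f (spec (Dmx d)) by rewrite specD.
have [C [r [C0 r0 GZ]]] := same_slope_tangents v (fun k => - c k) lipD Dpd Gsym.
have {}GZ s : 0 < s < r ->
    `|phi (Dmx d + s *: G) - phi (Dmx d + s *: Z)| <= C * s ^+ 2.
  move=> /GZ; rewrite (_ : G + _ = Z)// /Z; congr (_ + _).
  by rewrite -sumrN; apply: eq_bigr => k _; rewrite scaleNr.
have [m m0 md] := positive_vectors_near d0.
have y1 : 0 < 1 + `|y| by rewrite ltr_pwDl.
exists (N *m Q), C, (Num.min r (m / (1 + `|y|))); split=> //.
- split; first exact: symplectic_mul.
  by rewrite trmx_mul -!mulmxA (mulmxA N^T) (mulmxA _ N) NA mulmxA.
- by rewrite lt_min r0 divr_gt0.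
move=> s; rewrite lt_min ltr_pdivlMr// => /andP[s0 /andP[sr sy]].
(* [Q D_z Q^T] commutes with [J] and [Dmx d], so it is orthogonal to the tangent directions and
   pairs equally with [G] and [Z]. *)
have -> : half_diag ((N *m Q)^T *m H *m (N *m Q)) = y.
  apply: half_diag_eq => z.
  have -> : (N *m Q)^T *m H *m (N *m Q) = Q^T *m G *m Q.
    by rewrite /G trmx_mul !mulmxA.
  rewrite -QZ -(frobenius_dot_congr _ G) -(frobenius_dot_congr _ Z).
  set B := Q *m Dmx z *m Q^T.
  have GE : G = Z + \sum_k c k *: L k by rewrite /Z subrK.
  rewrite {1}GE /frobenius_dot mulmxDr linearD /=.
  suff -> : \tr (B^T *m (\sum_k c k *: L k)) = 0 by rewrite addr0.
  rewrite mulmx_sumr linear_sum big1// => k _ /=.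
  rewrite -scalemxAr linearZ /= -/(frobenius_dot B _) commute_tangent_orth ?mulr0//.
  - by rewrite /B !trmx_mul trmxK tr_Dmx mulmxA.
  - by rewrite trmx_mul trmxK.
  - have QJ' : Q^T *m J = J *m Q^T.
      by have := congr1 trmx QJ; rewrite !trmx_mul tr_Jmx mulNmx mulmxN => /oppr_inj.
    by rewrite /B -!mulmxA QJ' (mulmxA (Dmx z)) -Jmx_Dmx !mulmxA QJ.
  - have QD' : Q^T *m Dmx d = Dmx d *m Q^T.
      by have := congr1 trmx QD; rewrite !trmx_mul tr_Dmx.
    by rewrite /B -!mulmxA QD' (mulmxA (Dmx z)) Dmx_comm !mulmxA QD.
have -> : phi (A + s *: H) = phi (Dmx d + s *: G).
  rewrite -(symplectic_spectrum_congr _ NJ) mulmxDr mulmxDl NA.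
  by rewrite -scalemxAr -scalemxAl.
have <- : phi (Dmx d + s *: Z) = f (d + s *: y).
  rewrite -(symplectic_spectrum_congr _ QS) mulmxDr mulmxDl QDQ.
  rewrite -scalemxAr -scalemxAl QZ -DmxZ -DmxD spectral_function_Dmx//.
  apply: md; rewrite addrAC subrr add0r normrZ gtr0_norm//.
  by move: sy; rewrite mulrDr mulr1; lra.
by apply: GZ; rewrite s0.
Qed.

End SymmetricFunction.
End SpectralDerivative.

(** * The Clarke gradient of a spectral function *)

Section Subset.
Context {R : realType}.

(** The points satisfying the inequality include their supremum, by Lipschitz continuity; were it
    below [t], the slope condition there would produce a larger one. *)
Lemma dini_le (psi : R -> R) (t c L : R) : 0 < t ->
  (forall s s', 0 <= s <= t -> 0 <= s' <= t -> `|psi s - psi s'| <= L * `|s - s'|) ->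
  (forall s, 0 <= s < t -> exists2 e, 0 < e &
    forall h, 0 < h < e -> psi (s + h) - psi s <= h * c) ->
  psi t - psi 0 <= t * c.
Proof.
move=> t0 lip dini.
pose T := [set s | 0 <= s <= t /\ psi s - psi 0 <= s * c].
have T0 : T 0 by split; rewrite ?lexx ?(ltW t0)// subrr mul0r.
have supT : has_sup T by split; [exists 0|exists t => s [/andP[]]].
set S := sup T.
have S0 : 0 <= S by exact: ub_le_sup (proj2 supT) _ T0.
have St : S <= t by apply: ge_sup; [exists 0|move=> s [/andP[]]].
have L0 : 0 <= L.
  have := lip 0 t; rewrite !lexx ltW//= => /(_ isT isT) h.
  have := le_trans (normr_ge0 _) h.
  by rewrite pmulr_lge0// sub0r normrN normr_gt0 gt_eqF.
have TS : T S.
  split; first by rewrite S0 St.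
  rewrite leNgt; apply/negP => hS.
  have e0 : 0 < psi S - psi 0 - S * c by rewrite subr_gt0.
  pose k := L + `|c| + 1; have k0 : 0 < k by rewrite ltr_wpDl// addr_ge0.
  have ek : 0 < (psi S - psi 0 - S * c) / k by rewrite divr_gt0.
  have [s Ts sS] := sup_adherent ek supT; have [/andP[s0 st] sc] := Ts.
  have sS' : s <= S by exact: ub_le_sup (proj2 supT) _ Ts.
  have : `|psi S - psi s| <= L * (S - s).
    by rewrite -[S - s]ger0_norm ?subr_ge0//; apply: lip; rewrite ?S0 ?s0.
  move=> /ler_normlP[_ h1].
  have h2 : (s - S) * c <= `|c| * (S - s).
    by have := ler_norm (- c); rewrite normrN; nra.
  have h3 : (S - s) * k < psi S - psi 0 - S * c.
    by rewrite -ltr_pdivlMr//; move: sS; rewrite -/S; lra.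
  rewrite /k in h3; have h4 : s <= S := sS'.
  have : psi S - psi 0 - S * c <= (L + `|c|) * (S - s) by lra.
  by move: h3; nra.
have [_ Sc] := TS; case: (ltgtP S t) St => [St _|//|<- _]; last exact: Sc.
have [|e e0 he] := dini S; first by rewrite S0.
pose h := Num.min (e / 2) ((t - S) / 2).
have h0 : 0 < h by rewrite lt_min !divr_gt0 ?subr_gt0.
have h1 : h <= e / 2 by rewrite ge_min lexx.
have h2 : h <= (t - S) / 2 by rewrite ge_min lexx orbT.
have : T (S + h).
  split; first by apply/andP; split; lra.
  have := he h; rewrite h0 /= => /(_ _) h3.
  have := h3 ltac:(lra); lra.
by move=> /(ub_le_sup (proj2 supT)); rewrite -/S; lra.
Qed.

Context {n : nat}.
Implicit Types (M A B C G H Q Z : 'M[R]_(n + n)) (x y z w d g u : 'cV[R]_n).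
Local Notation J := (Jmx R n).
Local Notation spec := (@symplectic_spectrum R n).
Local Notation Sym := (symmetric_matrices R (n + n)).

(** [S i k] is half the sum of the squared entries of [M] between modes [k] and [i]. Orthogonality
    of [M] gives the row and column sums, commutation with [Dmx d] the block structure. *)
Lemma stabilizer_bistochastic d M u : positive_vectors R n d ->
  symplectic M -> M^T *m Dmx d *m M = Dmx d ->
  exists2 S : 'M[R]_n, block_bistochastic d S &
    half_diag (M^T *m Dmx u *m M) = S *m u.
Proof.
move=> d0 MJ MD; have [MM MJ' MD'] := symplectic_stabilizer d0 MJ MD.
pose S : 'M[R]_n := \matrix_(i, k) (2^-1 * (M (lshift n k) (lshift n i) ^+ 2 +
  M (rshift n k) (lshift n i) ^+ 2 + M (lshift n k) (rshift n i) ^+ 2 +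
  M (rshift n k) (rshift n i) ^+ 2)).
exists S; [split|].
- by move=> i j; rewrite mxE mulr_ge0// !addr_ge0// sqr_ge0.
- move=> i; under eq_bigr do rewrite mxE.
  have colE k : \sum_j (M (lshift n j) k ^+ 2) + \sum_j (M (rshift n j) k ^+ 2) = 1.
    have /matrixP/(_ k k) := MM; rewrite !mxE eqxx mulr1n big_split_ord /= => <-.
    by congr (_ + _); apply: eq_bigr => j _; rewrite mxE expr2.
  by rewrite -mulr_sumr !big_split /= colE -addrA colE; field.
- move=> i; under eq_bigr do rewrite mxE.
  have rowE k : \sum_j (M k (lshift n j) ^+ 2) + \sum_j (M k (rshift n j) ^+ 2) = 1.
    have /matrixP/(_ k k) := mulmx1C MM.
    rewrite !mxE eqxx mulr1n big_split_ord /= => <-.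
    by congr (_ + _); apply: eq_bigr => j _; rewrite mxE expr2.
  rewrite -mulr_sumr !big_split /=.
  have := rowE (lshift n i); have := rowE (rshift n i); lra.
- move=> i j; apply: contraNeq => dij.
  have M0 a b : mode a = j -> mode b = i -> M a b = 0.
    move=> aj bi; apply: (Dmx_commute MD'); rewrite !dblE aj bi eq_sym.
    by [].
  by rewrite mxE !M0 ?mode_lshift ?mode_rshift// expr0n !addr0 mulr0.
- apply/colP => i; rewrite [LHS]mxE [RHS]mxE.
  have E k : (M^T *m Dmx u *m M) k k =
      \sum_j u j 0 * (M (lshift n j) k ^+ 2 + M (rshift n j) k ^+ 2).
    rewrite -mulmxA mxE big_split_ord /= -big_split /=; apply: eq_bigr => j _.
    by rewrite !mul_Dmx dbl_lshift dbl_rshift !mxE; ring.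
  rewrite !E -big_split mulr_sumr; apply: eq_bigr => k _ /=.
  by rewrite mxE; ring.
Qed.

Lemma half_diag_sub G H : half_diag (G - H) = half_diag G - half_diag H.
Proof. by apply/colP => i; rewrite !mxE; ring. Qed.

Lemma norm_half_diag_le G : `|half_diag G| <= `|G|.
Proof.
apply: norm_mx_le => // i j; rewrite mxE normrM gtr0_norm ?invr_gt0//.
have := le_coord_norm G (lshift n i) (lshift n i).
have := le_coord_norm G (rshift n i) (rshift n i).
have := ler_normD (G (lshift n i) (lshift n i)) (G (rshift n i) (rshift n i)); lra.
Qed.

Lemma Dmx_sub x y : Dmx x - Dmx y = Dmx (x - y).
Proof. by rewrite DmxD -scaleN1r -DmxZ scaleN1r. Qed.

(* Compactness of the set of diagonalizing matrices. *)
Lemma SPup_near d (P : set 'M[R]_(n + n)) K r :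
  0 < r ->
  (forall B M, Sym B -> `|B - Dmx d| < r -> SPup B M ->
    `|spec B - d| <= K * `|B - Dmx d| /\ `|M| <= K) ->
  (forall M, symplectic M -> M^T *m Dmx d *m M = Dmx d -> nbhs M P) ->
  exists2 e, 0 < e &
    forall B M, Sym B -> `|B - Dmx d| < e -> SPup B M -> P M.
Proof.
move=> r0 BK PM.
pose Ball := [set M : 'M[R]_(n + n) | `|M| <= K].
have cBall : compact Ball.
  apply: (@compact_mx_bounded _ _ _ _ K) => //.
  apply: closed_comp (@closed_le R _) => M _; exact: norm_continuous.
pose Q B M := Sym B -> `|B - Dmx d| < r -> SPup B M -> P M.
have /nbhs_ballP[e /= e0 eX] : nbhs (Dmx d) [set B | Ball `<=` Q B].
  (* Each [M] of the ball needs a neighborhood of [(M, Dmx d)] where [Q] holds. If [M] is symplectic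
     outside the stabilizer, [M^T D_d M] is at distance [e > 0] from [D_d], whereas
     [M'^T B M' = D_(d(B))] is close to [D_d] for diagonalizing [M']. *)
  have /compact_near_coveringP cov := cBall.
  apply: (cov _ (nbhs (Dmx d)) Q (nbhs_filter _)) => M MK.
  have [MJ|MJ] := pselect (symplectic M); last first.
    exists (~` [set M | symplectic M], setT) => /=.
      split; last exact: filterT.
      apply: open_nbhs_nbhs; split=> //.
      by apply: closed_openC; exact: closed_symplectic.
    by move=> [M' B] /= [M'J _] _ _ [].
  have [MD|/eqP MD] := pselect (M^T *m Dmx d *m M = Dmx d).
    exists (P, setT) => /=; first by split; [exact: PM|exact: filterT].
    by move=> [M' B] /= [PM' _] _ _ _.
  set D := M^T *m Dmx d *m M in MD.
  pose e := `|D - Dmx d|; have e0 : 0 < e by rewrite normr_gt0 subr_eq0.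
  have cvgD :
      (fun MB : 'M[R]_(n + n) * 'M[R]_(n + n) => MB.1^T *m MB.2 *m MB.1) @
      filter_prod (nbhs M) (nbhs (Dmx d)) --> D.
    apply: cvg_mulmx; last exact: cvg_fst.
    apply: cvg_mulmx; last exact: cvg_snd.
    apply: cvg_trmx; exact: cvg_fst.
  have e2 : 0 < e / 2 by rewrite divr_gt0.
  have K1 : 0 < K + 1 by rewrite ltr_wpDl// (le_trans _ MK).
  have eK : 0 < e / 2 / (K + 1) by rewrite divr_gt0.
  have /cvgrPdist_lt/(_ _ e2) near1 := cvgD.
  have near2 : filter_prod (nbhs M) (nbhs (Dmx d))
      [set MB | `|MB.2 - Dmx d| < e / 2 / (K + 1)].
    exists (setT, [set B | `|B - Dmx d| < e / 2 / (K + 1)]) => /=.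
      split; first exact: filterT.
      apply/nbhs_ballP; exists (e / 2 / (K + 1)) => //= B.
      by rewrite -ball_normE /= distrC.
    by move=> [M' B] /= [].
  apply: filterS (filterI near1 near2) => -[M' B] /= [D1 D2] Bsym Br M'B.
  have [Bd _] := BK B M' Bsym Br M'B.
  have [_ M'BE] := M'B; rewrite M'BE in D1.
  have : e <= `|D - Dmx (spec B)| + `|Dmx (spec B) - Dmx d| by exact: ler_distD.
  rewrite Dmx_sub norm_Dmx.
  move: D2; rewrite ltr_pdivlMr//; have := normr_ge0 (B - Dmx d); lra.
exists (Num.min e r); first by rewrite lt_min e0.
move=> B M Bsym; rewrite lt_min => /andP[Be Br] MB.
have [_ MK] := BK B M Bsym Br MB.
by apply: (eX B) => //; rewrite -ball_normE /= distrC.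
Qed.

Lemma norm_perm_mx (s : 'S_n) x : `|perm_mx s *m x| = `|x|.
Proof.
have le s' z : `|perm_mx s' *m z| <= `|z|.
  by apply: norm_mx_le => // i j; rewrite ord1 mul_perm_cV le_coord_norm.
apply/eqP; rewrite eq_le le /=.
have {1}-> : x = perm_mx s^-1 *m (perm_mx s *m x).
  by rewrite mulmxA -perm_mxM mulVg perm_mx1 mul1mx.
exact: le.
Qed.

(** * Clarke bounds in diagonal directions *)

Section SymmetricFunction.
Variable f : 'cV[R]_n -> R.
Hypothesis f_sym : symmetric_function f.
Local Notation phi := (fun B => f (spec B)).

(** The radius is independent of [S]. Directions of norm at most [|u|] satisfying the inequality
    form a closed set, by the Lipschitz bound, and a convex one, by splitting the step; symmetry of
    [f] puts in the permutations of [u] fixing [d]. The condition on [|y - d| + t |u|] passes to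
    both parts of a split step. *)
Lemma clarke_bound_bistochastic d u a : positive_vectors R n d ->
  lipschitz_near f d -> clarke_bound setT f d u a ->
  exists2 e, 0 < e & forall S, block_bistochastic d S -> forall y t,
    0 < t < e -> `|y - d| + t * `|u| < e -> f (y + t *: (S *m u)) - f y <= t * a.
Proof.
move=> d0 [r [K [r0 K0 fK]]] [e0 e00 fu].
have [m m0 md] := positive_vectors_near d0.
pose e := Num.min e0 (Num.min r m).
have ee0 : e <= e0 by rewrite ge_min lexx.
have er : e <= r by rewrite !ge_min lexx orbT.
have em : e <= m by rewrite !ge_min lexx !orbT.
exists e; first by rewrite !lt_min e00 r0.
move=> S dS.
pose good := [set g : 'cV[R]_n | `|g| <= `|u| /\ forall y t,
  0 < t < e -> `|y - d| + t * `|u| < e -> f (y + t *: g) - f y <= t * a].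
suff : good (S *m u) by case.
have tg g t : `|g| <= `|u| -> 0 < t -> `|t *: g| <= t * `|u|.
  by move=> gu t0; rewrite normrZ gtr0_norm// ler_pM2l.
have yg g y t : `|g| <= `|u| -> 0 < t -> `|y + t *: g - d| <= `|y - d| + t * `|u|.
  by move=> gu t0; rewrite addrAC (le_trans (ler_normD _ _))// lerD2l tg.
apply: (bistochastic_mem (d := d) (c := `|u|) dS).
- move=> g gcl.
  have gu : `|g| <= `|u|.
    have : closed [set x : 'cV[R]_n | `|x| <= `|u|].
      by apply: closed_comp (@closed_le R _) => M _; exact: norm_continuous.
    by apply; apply: closure_subset gcl => x [].
  split=> // y t te yt; have /andP[t0 te'] := te.
  apply/ler_addgt0Pr => eta eta0.
  have eK : 0 < eta / (K * t) by rewrite divr_gt0// mulr_gt0.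
  have [h [[hu hgood]]] := gcl _ (nbhsx_ballx g _ eK).
  rewrite -ball_normE /= => gh.
  have h1 := hgood y t te yt.
  have h2 : `|f (y + t *: g) - f (y + t *: h)| <= eta.
    apply: le_trans (fK _ _ _ _) _.
    - by apply: le_lt_trans (yg _ _ _ gu t0) _; exact: lt_le_trans yt er.
    - by apply: le_lt_trans (yg _ _ _ hu t0) _; exact: lt_le_trans yt er.
    rewrite opprD addrACA subrr add0r -scalerBr normrZ gtr0_norm//.
    by rewrite mulrA mulrC ltW// -ltr_pdivlMr// mulr_gt0.
  by move: h2 => /ler_normlP[_]; lra.
- by move=> g [].
- move=> g h l [gu gg] [hu hh] /andP[l0 l1].
  have l1' : 0 < 1 - l by rewrite subr_gt0.
  have E : g + l *: (h - g) = (1 - l) *: g + l *: h.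
    by apply/matrixP => i j; rewrite !mxE; ring.
  split.
    rewrite E (le_trans (ler_normD _ _))// !normrZ !gtr0_norm//.
    have := ler_pM2l l0 `|h| `|u|; have := ler_pM2l l1' `|g| `|u|.
    rewrite gu hu => h1 h2; lra.
  move=> y t /andP[t0 te] yt.
  rewrite E scalerDr addrA !scalerA.
  have t1 : 0 < t * (1 - l) by rewrite mulr_gt0.
  have t2 : 0 < t * l by rewrite mulr_gt0.
  have U := normr_ge0 u.
  have tl1 : t * (1 - l) <= t by rewrite ler_piMr ?(ltW t0)// gerBl ltW.
  have tl2 : t * l <= t by rewrite ler_piMr ?(ltW t0)// ltW.
  have hg := gg y (t * (1 - l)); have hh' := hh (y + (t * (1 - l)) *: g) (t * l).
  have b1 : `|y - d| + t * (1 - l) * `|u| < e.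
    by have := ler_wpM2r U tl1; lra.
  have b2 : `|y + (t * (1 - l)) *: g - d| + t * l * `|u| < e.
    by have := yg g y _ gu t1; lra.
  have := hg; rewrite t1 (le_lt_trans tl1 te) b1 => /(_ isT isT) c1.
  have := hh'; rewrite t2 (le_lt_trans tl2 te) b2 => /(_ isT isT) c2.
  lra.
- move=> s ds; split; first by rewrite norm_perm_mx.
  move=> y t /andP[t0 te] yt.
  have ts : 0 < t < e0 by rewrite t0 (lt_le_trans te).
  have tu : 0 <= t * `|u| by rewrite mulr_ge0// ltW.
  have yd : `|y - d| < e by lra.
  have dE : perm_mx s *m d = d by apply/colP => i; rewrite mul_perm_cV ds.
  pose z := perm_mx s^-1 *m y.
  have yz : y = perm_mx s *m z by rewrite /z mulmxA -perm_mxM mulgV perm_mx1 mul1mx.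
  have zd : `|z - d| = `|y - d| by rewrite yz -{2}dE -mulmxBr norm_perm_mx.
  have z0 : positive_vectors R n z by apply: md; rewrite zd; exact: lt_le_trans yd em.
  have zt0 : positive_vectors R n (z + t *: u).
    apply: md; apply: le_lt_trans (yg _ _ _ (lexx _) t0) _.
    by rewrite zd; exact: lt_le_trans yt em.
  rewrite yz scalemxAr -mulmxDr (f_sym s zt0) (f_sym s z0); apply: fu => //.
  by rewrite zd; exact: lt_le_trans yd ee0.
Qed.

(* Along the segment from [B] to [B + t D_u] the spectrum moves in directions
   close to [S u] with [S] bistochastic on the blocks where [d] is constant. *)
Lemma spectral_clarke_bound_Dmx d u a b : is_symplectic_spectrum (Dmx d) d ->
  lipschitz_near f d -> a < b -> clarke_bound setT f d u a ->
  clarke_bound Sym phi (Dmx d) (Dmx u) b.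
Proof.
move=> dspec flip ab fu; have [d0 _ _] := dspec.
have specD := symplectic_spectrum_eq dspec.
have Dpd := positive_definite_Dmx d0.
have [e e0 feS] := clarke_bound_bistochastic d0 flip fu.
have [r1 r10 flip1] := lipschitz_near_open flip.
have [rf [Kf [rf0 Kf0 fK]]] := flip.
have flipD : lipschitz_near f (spec (Dmx d)) by rewrite specD.
have [r [K [r0 K0 phiK]]] := spectral_lipschitz Dpd flipD.
(* Error budget: [Kf eta = (b - a) / 3] pays for replacing the slope direction by [S u], and
   [(b - a) / 2] for the quadratic remainder; together less than [b - a]. *)
pose eta := (b - a) / (3 * Kf); have eta0 : 0 < eta.
  by rewrite divr_gt0 ?subr_gt0// mulr_gt0.
pose P := [set M : 'M[R]_(n + n) | exists2 S, block_bistochastic d S &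
  `|half_diag (M^T *m Dmx u *m M) - S *m u| < eta].
have DD : `|Dmx d - Dmx d| < r by rewrite subrr normr0.
have [||rho rho0 SPP] := @SPup_near d P K r r0.
- move=> B M Bsym Br MB; have [_ + _ MK] := phiK B _ Bsym (sym_Dmx d) Br DD.
  by rewrite specD => BD; split=> //; exact: MK.
- move=> M MJ MD; have [S dS SE] := stabilizer_bistochastic u d0 MJ MD.
  have cv : (fun N : 'M[R]_(n + n) => N^T *m Dmx u *m N) @ nbhs M -->
      M^T *m Dmx u *m M.
    apply: cvg_mulmx; last exact: cvg_id.
    apply: cvg_mulmx; last exact: cvg_cst.
    exact: trmx_continuous.
  have /cvgrPdist_lt/(_ _ eta0) := cv; apply: filterS => N NM; exists S => //.
  rewrite -SE -half_diag_sub (le_lt_trans (norm_half_diag_le _))//.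
  by rewrite distrC.
pose e3 := Num.min (Num.min r rho) (Num.min r1 (Num.min e rf) / K).
have e30 : 0 < e3 by rewrite !lt_min r0 rho0 divr_gt0// !lt_min r10 e0.
have e3r : e3 <= r by rewrite !ge_min lexx.
have e3rho : e3 <= rho by rewrite !ge_min lexx orbT.
have e3K : K * e3 <= Num.min r1 (Num.min e rf).
  by rewrite mulrC -ler_pdivlMr// ge_min lexx orbT.
have u1 : 0 < 1 + `|u| by rewrite ltr_pwDl.
exists (e3 / 2 / (1 + `|u|)); first by rewrite !divr_gt0.
move=> B t Bsym BD /andP[t0 tu].
have tu' : t * `|u| < e3 / 2.
  by move: tu; rewrite ltr_pdivlMr//; lra.
have BD' : `|B - Dmx d| < e3 / 2.
  apply: lt_le_trans BD _; rewrite ler_pdivrMr// ler_peMr ?lerDl//.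
  by rewrite divr_ge0// ltW.
have pathsym s : Sym (B + s *: Dmx u) by apply: symD => //; apply: symZ; exact: sym_Dmx.
have path s : 0 <= s <= t -> `|B + s *: Dmx u - Dmx d| < e3.
  move=> /andP[s0 st]; rewrite addrAC (le_lt_trans (ler_normD _ _))//.
  rewrite normrZ norm_Dmx ger0_norm//.
  by have := ler_wpM2r (normr_ge0 u) st; lra.
have pathr s : 0 <= s <= t -> `|B + s *: Dmx u - Dmx d| < r.
  by move=> /path h; exact: lt_le_trans h e3r.
have := @dini_le (fun s => phi (B + s *: Dmx u)) t b (K * `|u|) t0.
rewrite scale0r addr0; apply.
  move=> s s' st st'.
  have [_ _ h _] := phiK _ _ (pathsym s) (pathsym s') (pathr s st) (pathr s' st').
  apply: le_trans h _; rewrite opprD addrACA subrr add0r -scalerBl normrZ norm_Dmx.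
  by rewrite -mulrA [`|u| * _]mulrC.
move=> s /andP[s0 st]; have st' : 0 <= s <= t by rewrite s0 ltW.
set A := B + s *: Dmx u.
have [Apd Ad _ _] := phiK A _ (pathsym s) (sym_Dmx d) (pathr s st') DD.
have {}Ad : `|spec A - d| < Num.min r1 (Num.min e rf).
  rewrite specD in Ad; apply: le_lt_trans Ad _; apply: lt_le_trans e3K.
  by rewrite ltr_pM2l//; exact: path.
move: Ad; rewrite !lt_min => /andP[Ar1 /andP[Ae Arf]].
have [M [C [q [MA C0 q0 slope]]]] :=
  spectral_slope f_sym Apd (sym_Dmx u) (flip1 _ Ar1).
have [S dS gS] : P M.
  apply: (SPP A) => //; first exact: pathsym.
  exact: lt_le_trans (path _ st') e3rho.
set g := half_diag _ in slope gS.
have gu1 : 0 < 1 + `|u| + `|g| + `|S *m u| by rewrite !ltr_pwDl.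
pose q1 := Num.min (e - `|spec A - d|) (rf - `|spec A - d|).
have q10 : 0 < q1 by rewrite lt_min !subr_gt0 Ae.
have C1 : 0 < C + 1 by rewrite ltr_wpDl.
exists (Num.min (Num.min q e) (Num.min ((b - a) / 2 / (C + 1))
  (q1 / (1 + `|u| + `|g| + `|S *m u|)))).
  by rewrite !lt_min q0 e0 !divr_gt0 ?subr_gt0.
move=> h; rewrite !lt_min => /andP[h0 /andP[/andP[hq he] /andP[hC hq1]]].
move: hq1; rewrite ltr_pdivlMr// !mulrDr mulr1 => hq1.
have q1e : q1 <= e - `|spec A - d| by rewrite ge_min lexx.
have q1f : q1 <= rf - `|spec A - d| by rewrite ge_min lexx orbT.
have hu0 : 0 <= h * `|u| by rewrite mulr_ge0// ltW.
have hg0 : 0 <= h * `|g| by rewrite mulr_ge0// ltW.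
have hS0 : 0 <= h * `|S *m u| by rewrite mulr_ge0// ltW.
rewrite -[B + (s + h) *: _]/(B + (s + h) *: Dmx u) scalerDl addrA -/A.
have h0q : 0 < h < q by rewrite h0.
have /ler_normlP[_ s1] := slope h h0q.
have s2 := feS S dS (spec A) h; rewrite h0 he in s2.
have {}s2 := s2 isT ltac:(lra).
have near v : h * `|v| < rf - `|spec A - d| -> `|spec A + h *: v - d| < rf.
  move=> hv; rewrite addrAC (le_lt_trans (ler_normD _ _))// normrZ gtr0_norm//.
  by lra.
have s3 : `|f (spec A + h *: g) - f (spec A + h *: (S *m u))| <= Kf * (h * eta).
  apply: le_trans (fK _ _ (near _ _) (near _ _)) _; [lra|lra|].
  rewrite ler_pM2l// opprD addrACA subrr add0r -scalerBr normrZ gtr0_norm//.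
  by rewrite ler_pM2l// ltW.
move: s3 => /ler_normlP[_ s3].
have s4 : Kf * (h * eta) = h * ((b - a) / 3) by rewrite /eta; field; rewrite gt_eqF.
have s5 : C * h ^+ 2 <= h * ((b - a) / 2).
  move: hC; rewrite ltr_pdivlMr// => hC; nra.
have s6 : 0 < h * (b - a) by rewrite mulr_gt0// subr_gt0.
lra.
Qed.

End SymmetricFunction.

Lemma spectral_gradient_sub f A : symmetric_function f -> positive_definite A ->
  lipschitz_near f (spec A) ->
  clarke_gradient Sym (fun B => f (spec B)) A `<=`
  [set 2^-1 *: (M *m Dmx y *m M^T) |
    y in clarke_gradient setT f (spec A) & M in SPup A].
Proof.
move=> f_sym Apd flip Y /clarke_gradientP[Ysym YP].
have := symplectic_spectrumP Apd.
have specD := Dmx_spectrum Apd.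
set d := spec A in flip specD *; move=> [d0 ds [M0 M0J M0A]].
have Dspec : is_symplectic_spectrum (Dmx d) d.
  by rewrite -{2}specD; apply: symplectic_spectrumP; exact: positive_definite_Dmx.
have Dpd := positive_definite_Dmx d0.
have M0u := symplectic_unitmx M0J.
pose N := invmx M0; have NJ : symplectic N by exact: symplectic_invmx.
have NM0 : N *m M0 = 1%:M by exact: mulVmx.
have M0N : M0 *m N = 1%:M by exact: mulmxV.
have NDN : N^T *m Dmx d *m N = A.
  by rewrite -M0A !mulmxA -trmx_mul M0N trmx1 mul1mx -mulmxA M0N mulmx1.
(* The 2 undoes the 1/2 of the formula: in these coordinates [Z] has to become [Q D_y Q^T]. *)
pose Z := 2 *: (N *m Y *m N^T).
have Zsym : Z^T = Z by rewrite /Z linearZ /= !trmx_mul trmxK Ysym mulmxA.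
have YZ : Y = 2^-1 *: (M0 *m Z *m M0^T).
  rewrite /Z -scalemxAr -scalemxAl scalerA mulVf ?pnatr_eq0// scale1r.
  by rewrite !mulmxA M0N mul1mx -mulmxA -trmx_mul M0N trmx1 mulmx1.
have ZP G a : Sym G -> clarke_bound Sym (fun B => f (spec B)) (Dmx d) G a ->
    frobenius_dot Z G <= 2 * a.
  move=> Gsym Ga; have := spectral_clarke_bound_congr NJ Ga; rewrite NDN.
  move=> /(YP _ _ (sym_congr N Gsym)); rewrite -frobenius_dot_congr.
  rewrite /Z /frobenius_dot linearZ /= -scalemxAl linearZ /= => h.
  by rewrite ler_pM2l.
have flipD : lipschitz_near f (spec (Dmx d)) by rewrite specD.
have ZL (v : 'cV[R]_(n + n)) : frobenius_dot Z (tangent d (v *m v^T)) = 0.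
  (* The inequality holds for every real [c]; both signs force equality. *)
  have ZcL c : c * frobenius_dot Z (tangent d (v *m v^T)) <= 0.
    apply/ler_addgt0Pr => b b0; rewrite add0r.
    have b2 : 0 < b / 2 by rewrite divr_gt0.
    have := ZP _ _ _ (clarke_bound_tangent v c flipD Dpd b2).
    rewrite {1}/frobenius_dot -scalemxAr linearZ /= -/(frobenius_dot Z _).
    have -> : 2 * (b / 2) = b by field.
    by apply; apply: symZ; exact: tr_tangent.
  by have := ZcL 1; have := ZcL (-1); lra.
have [ZJ ZD] := tangent_orth_commute d0 Zsym (fun ij => ZL _).
have [Q [y [QQ QJ QD QZ]]] := codiagonalization Zsym ZJ ZD.
have QS : symplectic Q by rewrite /symplectic -mulmxA -QJ mulmxA QQ mul1mx.
have QQ' : Q *m Q^T = 1%:M by exact: mulmx1C.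
have QDQ : Q^T *m Dmx d *m Q = Dmx d by rewrite -mulmxA -QD mulmxA QQ mul1mx.
exists y.
  (* The bound along [u] becomes, with slack [e], one along [D_u] at [D_d]; congruence by [Q^T]
     fixes [D_d] and moves it to [Q D_u Q^T], whose pairing with [Z] is [2 <y, u>]. *)
  apply/clarke_gradientP; split=> // u a _ ua; apply/ler_addgt0Pr => e e0.
  have ae : a < a + e by rewrite ltrDl.
  have := spectral_clarke_bound_Dmx f_sym Dspec flip ae ua.
  have QTS : symplectic Q^T.
    by rewrite /symplectic trmxK; exact: symplectic_tr.
  move=> /(spectral_clarke_bound_congr QTS); rewrite trmxK.
  have -> : Q *m Dmx d *m Q^T = Dmx d by rewrite QD -mulmxA QQ' mulmx1.
  have symQ : Sym (Q *m Dmx u *m Q^T).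
    by rewrite -{1}[Q]trmxK; apply: sym_congr; exact: sym_Dmx.
  move=> /(ZP _ _ symQ).
  have -> : frobenius_dot Z (Q *m Dmx u *m Q^T) = 2 * frobenius_dot y u.
    rewrite -{1}[Q]trmxK -frobenius_dot_congr trmxK QZ.
    exact: frobenius_dot_Dmx_Dmx.
  by rewrite ler_pM2l.
exists (M0 *m Q).
  split; first exact: symplectic_mul.
  by rewrite trmx_mul -!mulmxA (mulmxA M0^T) (mulmxA _ M0) M0A mulmxA.
rewrite YZ -QZ trmx_mul !mulmxA; congr (_ *: _).
by rewrite -(mulmxA M0 Q) QQ' mulmx1 -(mulmxA _ Q Q^T) QQ' mulmx1.
Qed.

End Subset.

Theorem theorem3p13 (R : realType) (n : nat) (n_gt0 : (0 < n)%N)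
    (f : 'cV[R]_n -> R) (f_sym : symmetric_function f)
    (A : 'M[R]_(n + n)) (A_pd : positive_definite A)
    (f_lip : locally_lipschitz_near setT f (symplectic_spectrum A)) :
  clarke_gradient (symmetric_matrices R (n + n))
    (fun B => f (symplectic_spectrum B)) A =
  [set 2^-1 *: (M *m Dmx y *m M^T) |
    y in clarke_gradient setT f (symplectic_spectrum A) & M in SPup A].
Proof.
apply/seteqP; split.
- exact/spectral_gradient_sub/lipschitz_nearP.
- exact: spectral_gradient_sup.
Qed.
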